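(* The number of nonsingular $8\times 8$ matrices with all entries in $\{0,1\}$ is exactly $10160459763342013440$.
   Context: Nonsingularity (called regularity in the paper) is over the rationals, i.e. the integer determinant of the matrix is nonzero. *)

(* Defs.v *)
From mathcomp Require Import all_boot all_order all_algebra.

Set Implicit Arguments.
Unset Strict Implicit.
Unset Printing Implicit Defensive.

Import GRing.Theory.
Local Open Scope ring_scope.

(* A matrix with entries in {0,1} is encoded as a boolean matrix, so that the
   n x n ones form a finite type; this is the rational matrix it stands for. *)
Definition zero_one_mx (n : nat) (A : 'M[bool]_n) : 'M[rat]_n :=
  \matrix_(i, j) (if A i j then 1 else 0).

(* [unitmx] is taken over the field rat, where it means \det != 0; over int
   it would mean \det = 1 or \det = -1 *)
Definition nonsingular_zero_one (n : nat) : {set 'M[bool]_n} :=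
  [set A : 'M[bool]_n | zero_one_mx A \in unitmx].

(* Main.v *)
Require Import Defs.
From Stdlib Require Import BinPos BinNat.
From HB Require Import structures.
From mathcomp Require Import all_boot all_order all_algebra.
From mathcomp Require Import ring zify.

(** A nonsingular 8 x 8 matrix with entries 0 and 1 is an ordered 8-tuple of
    linearly independent points of the cube {0,1}^8.  Bordering the matrix turns
    it into a 9 x 9 matrix with entries 1 and -1 whose determinant is 2^8 times
    as large, so Hadamard's inequality ([det_gram]) bounds the determinant by
    3^9 / 2^8 < 79 ([det_int_mx_bound]).  Independence may therefore be tested
    over the field with 79 elements.

    Over a field, independent d-tuples from a list s of vectors are counted by
    choosing a first vector v and passing to the quotient by the line of v
    ([count_indep], [count_indepE]).  Let k_1, ..., k_8 be the standard basis and
    k_9 = (1, ..., 1).  Among the sums x_1 k_1 + ... + x_9 k_9 with signs x_i,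
    those with x_9 = 1 are the doubles of the points of {0,1}^8, and the others are
    their opposites.  The image in a quotient of the signed sums of nine vectors
    consists again of the signed sums of nine vectors, so every list that occurs is
    described by a configuration of nine vectors.
    The count attached to a configuration does not change when the nine vectors
    undergo a common invertible linear map, are permuted, or are multiplied by
    signs ([count_indep_map], [full_sums_sort], [full_sums_sign]), and vectors on
    the same line have the same quotient ([quot_scale]).

    So the count is computed dimension by dimension on weighted lists of
    configurations ([level]).  One step replaces each configuration by its
    quotients, brings these to a normal form and merges equal ones; it multiplies
    the count by a known factor ([level_count_absorb]).  Only 1, 4, 13, 54, 242
    and 1092 normal forms occur in dimensions 8, 7, 6, 5, 4 and 3.  In dimension 3
    the triples are counted directly: for a fixed point, two others are
    independent of it and of each other when their slopes in the quotient plane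
    differ ([count_indep_planar]).

    A normal form is reached by the moves just listed, hence has the same count
    ([count_indep_normal_form]).  Which moves are made is decided by a heuristic;
    the better it is, the more equivalent configurations are merged. *)

Set Implicit Arguments.
Unset Strict Implicit.
Unset Printing Implicit Defensive.

Import Order.TTheory GRing.Theory Num.Theory.
Local Open Scope ring_scope.

(** * Binary numbers as natural numbers *)

Lemma nat_of_binD m n : nat_of_bin (m + n)%num = (m + n)%N.
Proof. by case: m n => [|p] [|q] //=; rewrite ?addn0 ?nat_of_add_pos. Qed.

Lemma nat_of_binM m n : nat_of_bin (m * n)%num = (m * n)%N.
Proof. by case: m n => [|p] [|q] //=; rewrite ?muln0 ?nat_of_mul_pos. Qed.

(** Truncated subtraction is harmless where the difference is known in advance. *)
Lemma nat_of_bin_sub m n x :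
  nat_of_bin m = (x + nat_of_bin n)%N -> nat_of_bin (m - n)%num = x.
Proof.
move=> h; have -> : m = (bin_of_nat x + n)%num.
  by apply: (can_inj nat_of_binK); rewrite nat_of_binD bin_of_natK.
by rewrite N.add_sub bin_of_natK.
Qed.

(** Keeping both numbers abstract here prevents unification from unfolding the
    large ones to unary. *)
Lemma nat_of_bin_triple c n :
  N.eqb (3 * c) n -> nat_of_bin n = (3 * nat_of_bin c)%N.
Proof. by move=> /N.eqb_eq <-; rewrite nat_of_binM. Qed.

(** * The field with 79 elements *)

(** An enumerated type makes a field operation two case distinctions, which
    every evaluation strategy performs in a few steps. *)
Inductive F79 : Type :=
  | f0 | f1 | f2 | f3 | f4 | f5 | f6 | f7 | f8 | f9 | f10 | f11 | f12 | f13
  | f14 | f15 | f16 | f17 | f18 | f19 | f20 | f21 | f22 | f23 | f24 | f25 |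
  f26 | f27 | f28 | f29 | f30 | f31 | f32 | f33 | f34 | f35 | f36 | f37 |
  f38 | f39 | f40 | f41 | f42 | f43 | f44 | f45 | f46 | f47 | f48 | f49 |
  f50 | f51 | f52 | f53 | f54 | f55 | f56 | f57 | f58 | f59 | f60 | f61 |
  f62 | f63 | f64 | f65 | f66 | f67 | f68 | f69 | f70 | f71 | f72 | f73 |
  f74 | f75 | f76 | f77 | f78.

Definition F79_enum : seq F79 := [::
  f0; f1; f2; f3; f4; f5; f6; f7; f8; f9; f10; f11; f12; f13; f14; f15; f16;
  f17; f18; f19; f20; f21; f22; f23; f24; f25; f26; f27; f28; f29; f30; f31;
  f32; f33; f34; f35; f36; f37; f38; f39; f40; f41; f42; f43; f44; f45; f46;
  f47; f48; f49; f50; f51; f52; f53; f54; f55; f56; f57; f58; f59; f60; f61;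
  f62; f63; f64; f65; f66; f67; f68; f69; f70; f71; f72; f73; f74; f75; f76;
  f77; f78].

Definition F79_to_N (x : F79) : N :=
  match x with
  | f0 => 0 | f1 => 1 | f2 => 2 | f3 => 3 | f4 => 4 | f5 => 5 | f6 => 6 | f7
  => 7 | f8 => 8 | f9 => 9 | f10 => 10 | f11 => 11 | f12 => 12 | f13 => 13 |
  f14 => 14 | f15 => 15 | f16 => 16 | f17 => 17 | f18 => 18 | f19 => 19 |
  f20 => 20 | f21 => 21 | f22 => 22 | f23 => 23 | f24 => 24 | f25 => 25 |
  f26 => 26 | f27 => 27 | f28 => 28 | f29 => 29 | f30 => 30 | f31 => 31 |
  f32 => 32 | f33 => 33 | f34 => 34 | f35 => 35 | f36 => 36 | f37 => 37 |
  f38 => 38 | f39 => 39 | f40 => 40 | f41 => 41 | f42 => 42 | f43 => 43 |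
  f44 => 44 | f45 => 45 | f46 => 46 | f47 => 47 | f48 => 48 | f49 => 49 |
  f50 => 50 | f51 => 51 | f52 => 52 | f53 => 53 | f54 => 54 | f55 => 55 |
  f56 => 56 | f57 => 57 | f58 => 58 | f59 => 59 | f60 => 60 | f61 => 61 |
  f62 => 62 | f63 => 63 | f64 => 64 | f65 => 65 | f66 => 66 | f67 => 67 |
  f68 => 68 | f69 => 69 | f70 => 70 | f71 => 71 | f72 => 72 | f73 => 73 |
  f74 => 74 | f75 => 75 | f76 => 76 | f77 => 77 | f78 => 78
  end%num.

Definition F79_of_N (n : N) : F79 := nth f0 F79_enum (nat_of_bin (N.modulo n 79)).

(** Records the two arguments in the type of the goal, so that the tactics
    below can read off which entry of a table is asked for. *)
Definition tabulated (T : Type) (x y : F79) : Type := T.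

Ltac tabulate T f :=
  let x := fresh in let y := fresh in
  intros x y; change (tabulated T x y); destruct x, y;
  match goal with |- tabulated _ ?a ?b =>
    let r := eval vm_compute in (f a b) in exact r end.

Definition add79 : F79 -> F79 -> F79.
Proof. tabulate F79 (fun x y => F79_of_N (F79_to_N x + F79_to_N y)). Defined.

Definition mul79 : F79 -> F79 -> F79.
Proof. tabulate F79 (fun x y => F79_of_N (F79_to_N x * F79_to_N y)). Defined.

Definition cmp79 : F79 -> F79 -> comparison.
Proof. tabulate comparison (fun x y => N.compare (F79_to_N x) (F79_to_N y)). Defined.

Ltac tabulate1 T f :=
  let x := fresh in
  intros x; change (tabulated T x x); destruct x;
  match goal with |- tabulated _ ?a _ =>
    let r := eval vm_compute in (f a) in exact r end.

Definition opp79 : F79 -> F79.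
Proof. tabulate1 F79 (fun x => F79_of_N (79 - F79_to_N x)). Defined.

(** Fermat: the inverse is the power with exponent 77, and 0 is sent to 0. *)
Definition inv79 : F79 -> F79.
Proof. tabulate1 F79 (fun x => F79_of_N (F79_to_N x ^ 77)). Defined.

(** The representative of x and -x in the range 0, ..., 39. *)
Definition abs79 : F79 -> F79.
Proof.
tabulate1 F79 (fun x => F79_of_N (N.min (F79_to_N x) (79 - F79_to_N x))).
Defined.

Definition small79 : F79 -> bool.
Proof. tabulate1 bool (fun x => N.leb (F79_to_N x) 39). Defined.

Definition index79 : F79 -> positive.
Proof. tabulate1 positive (fun x => N.succ_pos (F79_to_N x)). Defined.

Fixpoint digits (p : positive) : seq bool :=
  match p with
  | xH => [::]
  | xO q => false :: digits q
  | xI q => true :: digits q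
  end.

(** A prefix code in which the most frequent elements 0 and 1 are short; the
    offset 126 gives all other elements the same length. *)
Definition code79 : F79 -> seq bool.
Proof.
tabulate1 (seq bool)
  (fun x => match x with
            | f0 => [:: false]
            | f1 => [:: true; false]
            | _ => [:: true, true & digits (Pos.add (index79 x) 126)]
            end).
Defined.

Definition is_f0 (x : F79) : bool := if x is f0 then true else false.

Arguments add79 : simpl never.
Arguments mul79 : simpl never.
Arguments opp79 : simpl never.
Arguments inv79 : simpl never.

Lemma F79_forall (P : F79 -> bool) : all P F79_enum -> forall x, P x.
Proof.
move=> hP; rewrite /= in hP.
repeat match type of hP with
| is_true (andb _ _) => case/andP: hP => ? hP
end.
by case.
Qed.

Lemma F79_forall2 (P : F79 -> F79 -> bool) :
  all (fun x => all (P x) F79_enum) F79_enum -> forall x y, P x y.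
Proof. by move=> h x y; move: y; apply: F79_forall; move: x; apply: F79_forall. Qed.

Definition F79_val (x : F79) : 'F_79 := (nat_of_bin (F79_to_N x))%:R.
Definition F79_of_val (a : 'F_79) : F79 := nth f0 F79_enum a.

Lemma F79_valK : cancel F79_val F79_of_val.
Proof.
by move=> x; rewrite /F79_of_val val_Fp_nat //; case: x; vm_compute.
Qed.

(** The quotient by 79 exhibits the congruence without a modulus on unary numbers. *)
Lemma F79_val_eq (m n : N) :
  N.eqb m (n + 79 * (m / 79)) ->
  (nat_of_bin m)%:R = (nat_of_bin n)%:R :> 'F_79.
Proof.
move=> /N.eqb_eq ->; rewrite nat_of_binD nat_of_binM natrD natrM.
by rewrite -[nat_of_bin 79]/79%N (pchar_Fp_0 (isT : prime 79)) mul0r addr0.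
Qed.

Lemma F79_val_inj : injective F79_val.
Proof. exact: can_inj F79_valK. Qed.

Lemma F79_valD x y : F79_val (add79 x y) = F79_val x + F79_val y.
Proof.
rewrite /F79_val -natrD -nat_of_binD; apply/esym/F79_val_eq.
move: x y; apply: F79_forall2; vm_cast_no_check (erefl true).
Qed.

Lemma F79_valM x y : F79_val (mul79 x y) = F79_val x * F79_val y.
Proof.
rewrite /F79_val -natrM -nat_of_binM; apply/esym/F79_val_eq.
move: x y; apply: F79_forall2; vm_cast_no_check (erefl true).
Qed.

Lemma F79_val0 : F79_val f0 = 0. Proof. by []. Qed.
Lemma F79_val1 : F79_val f1 = 1. Proof. by []. Qed.

Lemma F79_valN x : F79_val (opp79 x) = - F79_val x.
Proof.
apply/eqP; rewrite -addr_eq0 -F79_valD; apply/eqP.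
by rewrite (_ : add79 _ _ = f0) //; case: x.
Qed.

HB.instance Definition _ := Countable.copy F79 (can_type F79_valK).

Fact add79A : associative add79.
Proof. by move=> x y z; apply: F79_val_inj; rewrite !F79_valD addrA. Qed.
Fact add79C : commutative add79.
Proof. by move=> x y; apply: F79_val_inj; rewrite !F79_valD addrC. Qed.
Fact add790 : left_id f0 add79.
Proof. by move=> x; apply: F79_val_inj; rewrite F79_valD F79_val0 add0r. Qed.
Fact add79N : left_inverse f0 opp79 add79.
Proof. by move=> x; apply: F79_val_inj; rewrite F79_valD F79_valN addNr. Qed.

HB.instance Definition _ := GRing.isZmodule.Build F79 add79A add79C add790 add79N.

Fact mul79A : associative mul79.
Proof. by move=> x y z; apply: F79_val_inj; rewrite !F79_valM mulrA. Qed.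
Fact mul79C : commutative mul79.
Proof. by move=> x y; apply: F79_val_inj; rewrite !F79_valM mulrC. Qed.
Fact mul791 : left_id f1 mul79.
Proof. by move=> x; apply: F79_val_inj; rewrite F79_valM F79_val1 mul1r. Qed.
Fact mul79D : left_distributive mul79 add79.
Proof.
by move=> x y z; apply: F79_val_inj; rewrite !(F79_valM, F79_valD) mulrDl.
Qed.
Fact f1_neq0 : f1 != f0. Proof. by []. Qed.

HB.instance Definition _ :=
  GRing.Zmodule_isComNzRing.Build F79 mul79A mul79C mul791 mul79D f1_neq0.

Fact mul79V (x : F79) : x != 0 -> inv79 x * x = 1.
Proof. by case: x. Qed.
Fact inv790 : inv79 0 = 0. Proof. by []. Qed.

HB.instance Definition _ := GRing.ComNzRing_isField.Build F79 mul79V inv790.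

Lemma add79E : add79 = +%R. Proof. by []. Qed.
Lemma mul79E : mul79 = *%R. Proof. by []. Qed.
Lemma opp79E : opp79 = -%R. Proof. by []. Qed.
Lemma inv79E : inv79 = GRing.inv. Proof. by []. Qed.
Lemma is_f0E x : is_f0 x = (x == 0). Proof. by case: x. Qed.

Lemma F79_natr n : (n%:R == 0 :> F79) = (79 %| n)%N.
Proof.
have hv : F79_val n%:R = n%:R.
  by elim: n => // n ih; rewrite !mulrS -ih -F79_val1 -F79_valD.
rewrite -(inj_eq F79_val_inj) hv -(dvdn_pcharf (pchar_Fp (isT : prime 79))) //.
Qed.

Definition eq79 (x y : F79) : bool := if cmp79 x y is Eq then true else false.

Lemma eq79P x y : eq79 x y -> x = y.
Proof.
suff : eq79 x y ==> N.eqb (F79_to_N x) (F79_to_N y).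
  move=> + e; rewrite e => /N.eqb_eq h.
  by apply: F79_val_inj; rewrite /F79_val h.
move: x y; apply: F79_forall2; vm_cast_no_check (erefl true).
Qed.

Lemma index79_eq x y : Pos.eqb (index79 x) (index79 y) = (x == y).
Proof.
apply/idP/eqP => [|->]; last exact: Pos.eqb_refl.
move=> h; apply: eq79P; move: h; apply/implyP.
by move: x y; apply: F79_forall2; vm_cast_no_check (erefl true).
Qed.

(** * Vectors *)

Notation vec := (seq F79).
Notation config := (seq vec).
Notation level := (seq (config * N)).

Fixpoint vadd (u v : vec) : vec :=
  match u, v with
  | a :: u', b :: v' => add79 a b :: vadd u' v'
  | _, _ => [::]
  end.

Definition vscale (c : F79) : vec -> vec := map (mul79 c).

Definition vopp : vec -> vec := map opp79.

Fixpoint axpy (c : F79) (p v : vec) : vec :=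
  match p, v with
  | a :: p', b :: v' => add79 b (mul79 c a) :: axpy c p' v'
  | _, _ => [::]
  end.

Fixpoint nonzero (v : vec) : bool :=
  if v is a :: v' then if is_f0 a then nonzero v' else true else false.

Lemma size_vadd u v : size (vadd u v) = minn (size u) (size v).
Proof. by elim: u v => [|a u ih] [|b v] //=; rewrite ?minn0 // ih minnSS. Qed.

Lemma size_vscale c v : size (vscale c v) = size v.
Proof. exact: size_map. Qed.

Lemma vaddC : commutative vadd.
Proof. by elim=> [|a u ih] [|b v] //=; rewrite ih add79C. Qed.

Lemma vaddA : associative vadd.
Proof. by elim=> [|a u ih] [|b v] [|c w] //=; rewrite ih add79A. Qed.

Lemma vaddCA : left_commutative vadd.
Proof. by move=> u v w; rewrite !vaddA (vaddC u). Qed.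

Lemma vaddACA : interchange vadd vadd.
Proof. by move=> u v w x; rewrite -!vaddA (vaddCA v). Qed.

Lemma vscaleDr c u v : vscale c (vadd u v) = vadd (vscale c u) (vscale c v).
Proof.
by elim: u v => [|a u ih] [|b v] //=; rewrite ih mul79E add79E mulrDr.
Qed.

Lemma vscaleDl a b v : vscale (a + b) v = vadd (vscale a v) (vscale b v).
Proof. by elim: v => //= c v ->; rewrite mul79E add79E mulrDl. Qed.

Lemma vscaleA a b v : vscale a (vscale b v) = vscale (a * b) v.
Proof. by rewrite /vscale -map_comp; apply: eq_map => x /=; rewrite mul79A. Qed.

Lemma vscale1 v : vscale 1 v = v.
Proof. by rewrite /vscale -[RHS]map_id; apply: eq_map => x; rewrite -[LHS]/(1 * x) mul1r. Qed.

Lemma vscale0 v : vscale 0 v = nseq (size v) 0.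
Proof. by elim: v => //= a v ->; rewrite mul79E mul0r. Qed.

Lemma vscaler0 c n : vscale c (nseq n 0) = nseq n 0.
Proof. by rewrite /vscale map_nseq mul79E mulr0. Qed.

Lemma vadd0 n v : size v = n -> vadd (nseq n 0) v = v.
Proof. by elim: v n => [|a v ih] [|n] //= [] /ih ->; rewrite add79E add0r. Qed.

Lemma voppE v : vopp v = vscale (- 1) v.
Proof. by apply: eq_map => x; rewrite -[RHS]/(- 1 * x) mulN1r. Qed.

Lemma voppK : involutive vopp.
Proof. by move=> v; rewrite !voppE vscaleA mulrNN mulr1 vscale1. Qed.

Lemma voppD u v : vopp (vadd u v) = vadd (vopp u) (vopp v).
Proof. by rewrite !voppE vscaleDr. Qed.

Lemma axpyE c p v : axpy c p v = vadd v (vscale c p).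
Proof. by elim: p v => [|a p ih] [|b v] //=; rewrite ih. Qed.

Lemma nonzeroE v : nonzero v = (v != nseq (size v) 0).
Proof.
elim: v => //= a v ->; rewrite is_f0E.
by have [->|ha] := eqVneq a 0; rewrite eqseq_cons ?eqxx //= (negPf ha).
Qed.

Lemma nonzero_nseq n : nonzero (nseq n 0) = false.
Proof. by rewrite nonzeroE size_nseq eqxx. Qed.

Lemma nonzeroPn n v : size v = n -> reflect (v = nseq n 0) (~~ nonzero v).
Proof. by move=> <-; rewrite nonzeroE negbK; apply: eqP. Qed.

Lemma nonzero_scale c v : c != 0 -> nonzero (vscale c v) = nonzero v.
Proof.
move=> hc; elim: v => //= a v ->.
by rewrite !is_f0E mul79E mulf_eq0 (negPf hc).
Qed.

Lemma nonzero_opp v : nonzero (vopp v) = nonzero v.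
Proof. by rewrite voppE nonzero_scale. Qed.

Fixpoint normalize (v : vec) : vec :=
  if v is a :: v' then
    if is_f0 a then a :: normalize v' else f1 :: vscale (inv79 a) v'
  else [::].

Lemma normalizeE v : nonzero v -> exists2 c, c != 0 & normalize v = vscale c v.
Proof.
elim: v => //= a v ih; rewrite is_f0E; case: eqVneq => [-> /ih [c hc ->]|ha _].
  by exists c => //; rewrite /= mul79E mulr0.
by exists a^-1; rewrite ?invr_eq0 //= mul79E mulVf.
Qed.

(** * The quotient by a line *)

Fixpoint coef (p v : vec) : F79 :=
  match p, v with
  | a :: p', b :: v' => if is_f0 a then coef p' v' else mul79 b (inv79 a)
  | _, _ => f0
  end.

(** The quotient by the line of p: the first nonzero coordinate of p is used to
    eliminate that coordinate from v, and is then dropped. *)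
Fixpoint quot (p v : vec) : vec :=
  match p, v with
  | a :: p', b :: v' =>
      if is_f0 a then b :: quot p' v'
      else axpy (opp79 (mul79 b (inv79 a))) p' v'
  | _, _ => [::]
  end.

(** The coefficient lost in the quotient becomes the last coordinate, so that
    this is an invertible change of coordinates (when p is not 0) that sends p to
    the last basis vector. *)
Definition pivot (p v : vec) : vec := rcons (quot p v) (coef p v).

Lemma size_quot p v :
  size p = size v -> nonzero p -> size (quot p v) = (size v).-1.
Proof.
elim: p v => [|a p ih] [|b v] //= [e]; case: ifP => _ /=.
  move=> hp; rewrite ih //; case: v {ih} e => // e.
  by case: p hp e.
by move=> _; rewrite axpyE size_vadd size_vscale e minnn.
Qed.

Lemma quotD p u v : quot p (vadd u v) = vadd (quot p u) (quot p v).
Proof.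
elim: p u v => [|a p ih] [|b u] [|c v] //=; case: ifP => _ //=.
- by rewrite vaddC.
- by rewrite ih.
rewrite !axpyE vaddACA -vscaleDl.
by rewrite !(add79E, mul79E, opp79E) mulrDl opprD.
Qed.

Lemma quotZ p c v : quot p (vscale c v) = vscale c (quot p v).
Proof.
elim: p v => [|a p ih] [|b v] //=; case: ifP => _ /=; first by rewrite ih.
by rewrite !axpyE vscaleDr vscaleA !(mul79E, opp79E) mulrN mulrA.
Qed.

Lemma quotN p v : quot p (vopp v) = vopp (quot p v).
Proof. by rewrite !voppE quotZ. Qed.

Lemma quot_scale c p v : c != 0 -> quot (vscale c p) v = quot p v.
Proof.
move=> hc; elim: p v => [|a p ih] [|b v] //=.
rewrite !is_f0E mul79E mulf_eq0 (negPf hc) /=.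
case: ifP => ha; first by rewrite ih.
rewrite !axpyE vscaleA !(inv79E, opp79E) invfM; congr (vadd _ (vscale _ _)).
by rewrite mulNr; congr (- _); rewrite -mulrA mulrAC mulVf // mul1r.
Qed.

Lemma quot_opp p v : quot (vopp p) v = quot p v.
Proof. by rewrite voppE quot_scale. Qed.

Lemma quot_id p : nonzero p -> nonzero (quot p p) = false.
Proof.
elim: p => //= a p ih; rewrite is_f0E; case: eqVneq => [->|ha] /=; first exact: ih.
move=> _; rewrite axpyE !(mul79E, inv79E, opp79E) divff //.
by rewrite -{1}(vscale1 p) -vscaleDl subrr vscale0 nonzero_nseq.
Qed.

(** Together with [quot_id]: the kernel of the quotient map is the line of p. *)
Lemma quot_eq0 p v : size p = size v -> nonzero p -> ~~ nonzero (quot p v) ->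
  v = vscale (coef p v) p.
Proof.
elim: p v => [|a p ih] [|b v] //= [e]; rewrite is_f0E.
case: eqVneq => [->|ha] /=.
  rewrite is_f0E; case: eqVneq => //= -> hp hq.
  by rewrite mul79E mulr0 {1}(ih v e hp hq).
move=> _; rewrite axpyE => /(nonzeroPn (n := size v)).
rewrite size_vadd size_vscale e minnn => /(_ erefl) h.
rewrite !(mul79E, inv79E) divfK //; congr cons.
have e0 : vadd (vscale (- (b / a)) p) (vscale (b / a) p) = nseq (size v) 0.
  by rewrite -vscaleDl addNr vscale0 e.
rewrite -[LHS](vadd0 (n := size v)) // -e0 -vaddA vaddC -vaddA.
by rewrite -[vscale (- (b / a)) p]/(vscale (opp79 (mul79 b (inv79 a))) p) h
  vaddC vadd0 // size_vscale.
Qed.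

Lemma coefD p u v : size p = size u -> size p = size v ->
  coef p (vadd u v) = coef p u + coef p v.
Proof.
elim: p u v => [|a p ih] [|b u] [|c v] // [eu] [ev] /=.
case: ifP => _; first by rewrite ih.
by rewrite mul79E add79E mulrDl.
Qed.

Lemma coefZ p c v : coef p (vscale c v) = c * coef p v.
Proof.
elim: p v => [|a p ih] [|b v] /=; rewrite ?mulr0 //.
case: ifP => _; first by rewrite ih.
by rewrite !mul79E mulrA.
Qed.

(** * Linear independence *)

Definition of_size (d : nat) (v : vec) : bool := size v == d.

Fixpoint lincomb (d : nat) (c : seq F79) (t : seq vec) : vec :=
  match c, t with
  | a :: c', v :: t' => vadd (vscale a v) (lincomb d c' t')
  | _, _ => nseq d 0
  end.

Fixpoint indep (n : nat) (t : seq vec) : bool :=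
  match n, t with
  | n'.+1, p :: t' => nonzero p && indep n' (map (quot p) t')
  | _, _ => true
  end.

Lemma size_lincomb d c t : all (of_size d) t -> size (lincomb d c t) = d.
Proof.
elim: c t => [|a c ih] [|v t] /=; rewrite ?size_nseq //.
by case/andP=> /eqP e /ih; rewrite size_vadd size_vscale e => ->; rewrite minnn.
Qed.

Lemma lincomb0 d t : all (of_size d) t ->
  lincomb d (nseq (size t) 0) t = nseq d 0.
Proof.
elim: t => //= v t ih /andP[/eqP ev /ih ->].
by rewrite vscale0 ev vadd0 // size_nseq.
Qed.

Lemma all_size_quot d p t : size p = d.+1 -> nonzero p ->
  all (of_size d.+1) t -> all (of_size d) (map (quot p) t).
Proof.
move=> ep hp ht; rewrite all_map; apply: sub_all ht => v /eqP e /=.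
by rewrite /of_size size_quot ?ep ?e.
Qed.

Lemma quot_zero d p : size p = d.+1 -> nonzero p ->
  quot p (nseq d.+1 0) = nseq d 0.
Proof. by move=> ep hp; rewrite -ep -vscale0 quotZ vscale0 size_quot // ep. Qed.

Lemma quot_lincomb d p c t : size p = d.+1 -> nonzero p ->
  all (of_size d.+1) t ->
  quot p (lincomb d.+1 c t) = lincomb d c (map (quot p) t).
Proof.
move=> ep hp; have h0 := quot_zero ep hp; elim: c t => [|a c ih] [|v t] //= /andP[/eqP ev ht].
by rewrite quotD quotZ ih.
Qed.

(** The recursive test is ordinary linear independence.  In a relation between
    p and the vectors of t, the quotient by p leaves a relation between the images
    of t; conversely a relation between the images lifts to one that involves p,
    because the kernel of the quotient map is the line of p. *)
Lemma indepP d t : all (of_size d) t ->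
  indep (size t) t <->
  forall c, size c = size t -> lincomb d c t = nseq d 0 -> c = nseq (size t) 0.
Proof.
have [n] := ubnP (size t); elim: n t d => // n ih' [|p t] d /=.
  by split=> // _ c /size0nil.
rewrite ltnS => hn.
case/andP=> /eqP ep ht; split=> [/andP[hp hi] [|a c] //= [ec]|h].
  case: d ep ht => [|d] ep ht; first by case: p ep hp hi.
  have hc : size c = size (map (quot p) t) by rewrite size_map.
  have hq := all_size_quot ep hp ht.
  move=> e; have /= := congr1 (quot p) e.
  rewrite quotD quotZ quot_lincomb //.
  have -> : quot p p = nseq d 0.
    by apply/nonzeroPn; rewrite ?quot_id // size_quot // ep.
  rewrite vscaler0 vadd0 ?size_lincomb // quot_zero // => e'.
  have e0 : c = nseq (size t) 0.
    have := ih' (map (quot p) t) d; rewrite size_map => /(_ hn hq) [h _].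
    by rewrite size_map in hc; apply: h.
  congr cons => //; move: e; rewrite e0.
  rewrite lincomb0 // vaddC vadd0 ?size_vscale // => /eqP ea; apply/eqP; apply: contraT => ha.
  by rewrite -(nonzero_scale p ha) nonzeroE size_vscale ep ea in hp.
have hp : nonzero p.
  apply: contraT => /(nonzeroPn ep) e0.
  have /= := h (1 :: nseq (size t) 0); rewrite size_nseq => /(_ erefl).
  rewrite e0 vscaler0 vadd0 ?size_lincomb // lincomb0 // => /(_ erefl) [/eqP].
  by rewrite oner_eq0.
rewrite hp /=; case: d ep ht h => [|d] ep ht h; first by case: p ep hp {h}.
have hq := all_size_quot ep hp ht.
rewrite -(size_map (quot p) t); apply/ih'; rewrite ?size_map //; first exact: hq.
move=> c => ec; rewrite -quot_lincomb // => e.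
have el : lincomb d.+1 c t = vscale (coef p (lincomb d.+1 c t)) p.
  apply: quot_eq0; rewrite ?size_lincomb // e.
  by rewrite nonzero_nseq.
move: el; set k := coef _ _ => el.
have /= := h (- k :: c); rewrite ec el -vscaleDl addNr vscale0 ep.
by move=> /(_ erefl erefl) [_].
Qed.

(** The order of elimination is irrelevant for linear independence, hence for
    the recursive test. *)
Lemma indep_swap d u v t : all (of_size d) [:: u, v & t] ->
  indep (size t).+2 [:: u, v & t] = indep (size t).+2 [:: v, u & t].
Proof.
suff h a b : all (of_size d) [:: a, b & t] ->
    indep (size t).+2 [:: a, b & t] -> indep (size t).+2 [:: b, a & t].
  move=> huv; apply/idP/idP; apply: h => //.
  by move: huv => /= /andP[-> /andP[-> ->]].
move=> hab; have hba : all (of_size d) [:: b, a & t].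
  by move: hab => /= /andP[-> /andP[-> ->]].
move/(indepP hab) => h; apply/(indepP hba) => -[|x [|y c]] //= [ec] e.
have /= := h [:: y, x & c]; rewrite ec => /(_ erefl).
by rewrite vaddCA => /(_ e) [-> -> ->].
Qed.

(** * Counting independent tuples *)

Fixpoint count_indep (d : nat) (s : seq vec) : nat :=
  if d is d'.+1 then
    (\sum_(v <- s | nonzero v) count_indep d' (map (quot v) s))%N
  else 1.

Fixpoint tuples (T : Type) (n : nat) (s : seq T) : seq (seq T) :=
  if n is n'.+1 then [seq v :: t | v <- s, t <- tuples n' s] else [:: [::]].

Lemma tuples_map T U (f : T -> U) n s :
  tuples n (map f s) = map (map f) (tuples n s).
Proof.
elim: n => //= n ->; rewrite allpairs_mapl allpairs_mapr map_allpairs.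
by [].
Qed.

Lemma all_tuples T (P : pred T) n s :
  all P s -> all (fun t => (size t == n) && all P t) (tuples n s).
Proof.
move=> hs; elim: n => //= n ih; move: (tuples n s) ih => l ih.
elim: s hs => //= v s ihs /andP[hv hs].
rewrite all_cat ihs // andbT all_map; apply: sub_all ih => t /=.
by rewrite eqSS hv.
Qed.

(** Tuples with first vector v that are independent correspond to independent
    tuples in the quotient by v. *)
Lemma count_indepE d s : count_indep d s = count (indep d) (tuples d s).
Proof.
elim: d s => //= d ih s.
rewrite count_flatten sumnE !big_map big_mkcond /=; apply: eq_bigr => v _.
rewrite count_map /=; case: ifP => hv.
  by rewrite ih tuples_map count_map; apply: eq_count => t /=; rewrite hv.
by rewrite (eq_count (a2 := pred0)) ?count_pred0 // => t /=; rewrite hv.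
Qed.

(** Injectivity is stated through the kernel, as it is proved and used. *)
Definition injective_linear (d : nat) (g : vec -> vec) : Prop :=
  [/\ forall v, size v = d -> size (g v) = d,
      forall u v, size u = d -> size v = d -> g (vadd u v) = vadd (g u) (g v),
      forall c v, size v = d -> g (vscale c v) = vscale c (g v) &
      forall v, size v = d -> ~~ nonzero (g v) -> ~~ nonzero v].

Lemma map_lincomb d g c t : injective_linear d g -> all (of_size d) t ->
  lincomb d c (map g t) = g (lincomb d c t).
Proof.
move=> [hs hD hZ _]; have h0 : nseq d 0 = g (nseq d 0).
  rewrite -{2}(vscaler0 0 d) hZ ?size_nseq // vscale0 hs ?size_nseq //.
elim: c t => [|a c ih] [|v t] //= /andP[/eqP ev ht].
by rewrite hD ?hZ ?ih // ?size_vscale ?size_lincomb.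
Qed.

Lemma all_size_map d g t : injective_linear d g ->
  all (of_size d) t -> all (of_size d) (map g t).
Proof.
move=> [hs _ _ _] ht; rewrite all_map; apply: sub_all ht => v /eqP /hs e.
by rewrite /= /of_size e.
Qed.

Lemma indep_map d g t : injective_linear d g -> all (of_size d) t ->
  indep (size t) (map g t) = indep (size t) t.
Proof.
move=> hg ht; rewrite -{1}(size_map g t).
apply/idP/idP.
  move/(indepP (all_size_map hg ht)) => h; apply/(indepP ht) => c ec e.
  rewrite -(size_map g t); apply: h; rewrite ?size_map //.
  rewrite map_lincomb // e; have [hs _ hZ _] := hg.
  by rewrite -(vscaler0 0 d) hZ ?size_nseq // vscale0 hs ?size_nseq ?vscaler0.
move/(indepP ht) => h; apply/(indepP (all_size_map hg ht)) => c.
rewrite size_map => ec; rewrite map_lincomb // => e; apply: h => //.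
have [_ _ _ hk] := hg; apply/nonzeroPn; first exact: size_lincomb.
by apply: hk; rewrite ?size_lincomb // e nonzero_nseq.
Qed.

Lemma count_indep_map d n g s : injective_linear d g -> all (of_size d) s ->
  count_indep n (map g s) = count_indep n s.
Proof.
move=> hg hs; rewrite !count_indepE tuples_map count_map.
have := all_tuples n hs; elim: (tuples n s) => //= t l ih /andP[/andP[/eqP ht hall] /ih ->].
by rewrite -{1 3}ht (indep_map hg hall).
Qed.

Lemma count_indep_perm n s s' :
  perm_eq s s' -> count_indep n s = count_indep n s'.
Proof.
elim: n s s' => //= n ih s s' h; rewrite (perm_big _ h) /=.
by apply: eq_bigr => v _; apply: ih; apply: perm_map.
Qed.

Lemma map_opp_quot v s :
  map (quot v) (map vopp s) = map vopp (map (quot v) s).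
Proof. by rewrite -!map_comp; apply: eq_map => w /=; rewrite quotN. Qed.

(** Replacing any of the n vectors by its opposite preserves independence. *)
Lemma count_indep_sym d n s : all (of_size d) s -> (n <= d)%N ->
  count_indep n (s ++ map vopp s) = (2 ^ n * count_indep n s)%N.
Proof.
elim: n d s => [|n ih] [|d] //= s hs hn.
have h v : v \in s -> nonzero v ->
    count_indep n (map (quot v) (s ++ map vopp s)) =
    (2 ^ n * count_indep n (map (quot v) s))%N.
  move=> hv nv; have ev : size v = d.+1 by apply/eqP/(allP hs).
  rewrite map_cat map_opp_quot (ih d) //.
  exact: all_size_quot.
rewrite big_cat big_map /=.
have -> : (\sum_(v <- s | nonzero (vopp v))
    count_indep n (map (quot (vopp v)) (s ++ map vopp s)) =
    \sum_(v <- s | nonzero v) count_indep n (map (quot v) (s ++ map vopp s)))%N.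
  apply: eq_big => v; first by rewrite nonzero_opp.
  by move=> _; congr count_indep; apply: eq_map => w; rewrite quot_opp.
rewrite addnn -mul2n expnS -mulnA; congr (2 * _)%N; rewrite big_distrr /=.
rewrite big_seq_cond [RHS]big_seq_cond; apply: eq_bigr => v /andP[hv nv].
exact: h.
Qed.

(** * Signed sums of a configuration *)

Fixpoint full_sums (d : nat) (K : config) : seq vec :=
  if K is v :: K' then
    let s := full_sums d K' in map (vadd v) s ++ map (vadd (vopp v)) s
  else [:: nseq d 0].

(** The sign of the last vector is fixed, which leaves one of each pair u, -u. *)
Fixpoint half_sums (K : config) : seq vec :=
  match K with
  | [::] => [::]
  | [:: v] => [:: v]
  | v :: K' =>
      let s := half_sums K' in
      let v' := vopp v in map (vadd v) s ++ map (vadd v') s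
  end.

Lemma all_size_full d K : all (of_size d) K -> all (of_size d) (full_sums d K).
Proof.
rewrite /of_size; elim: K => [|v K ih] /=; first by rewrite size_nseq eqxx.
case/andP=> /eqP ev /ih h; rewrite all_cat !all_map.
by apply/andP; split; apply: sub_all h => u /eqP eu;
  rewrite /= size_vadd ?size_map eu ev minnn.
Qed.

Lemma full_sums_map d e g K :
  (forall u v, size u = d -> size v = d -> g (vadd u v) = vadd (g u) (g v)) ->
  (forall c v, size v = d -> g (vscale c v) = vscale c (g v)) ->
  g (nseq d 0) = nseq e 0 ->
  all (of_size d) K -> full_sums e (map g K) = map g (full_sums d K).
Proof.
move=> hD hZ h0; elim: K => /= [_|v K ih /andP[/eqP ev hK]]; first by rewrite h0.
rewrite ih // map_cat -!map_comp; have /allP hs := all_size_full hK.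
congr (_ ++ _); apply/eq_in_map => u /hs /eqP eu /=; rewrite hD ?size_map //.
by rewrite !voppE hZ.
Qed.

(** Passing to a quotient is a move between configurations: this is what keeps
    the whole recursion among lists of nine vectors. *)
Lemma full_sums_quot d p K : size p = d.+1 -> nonzero p ->
  all (of_size d.+1) K ->
  full_sums d (map (quot p) K) = map (quot p) (full_sums d.+1 K).
Proof.
move=> ep hp; apply: full_sums_map.
- by move=> u v _ _; rewrite quotD.
- by move=> c v _; rewrite quotZ.
- exact: quot_zero.
Qed.

Lemma full_sums_linear d g K : injective_linear d g -> all (of_size d) K ->
  full_sums d (map g K) = map g (full_sums d K).
Proof.
case=> hs hD hZ _; apply: full_sums_map => //.
by rewrite -(vscaler0 0 d) hZ ?size_nseq // vscale0 hs ?size_nseq ?vscaler0.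
Qed.

Lemma full_sums_half d K : all (of_size d) K -> K != [::] ->
  perm_eq (full_sums d K) (half_sums K ++ map vopp (half_sums K)).
Proof.
elim: K => //= v K ih /andP[/eqP ev hK] _.
case: K ih hK => [_ _|w K] /=.
  by rewrite !(vaddC _ (nseq d 0)) !vadd0 ?size_map.
set H := half_sums (w :: K); set F := full_sums d (w :: K) => ih hK.
have {}ih : perm_eq F (H ++ map vopp H) by apply: ih.
apply: (perm_trans (perm_cat (perm_map _ ih) (perm_map _ ih))).
rewrite !map_cat -!map_comp.
have e1 : map (vopp \o vadd v) H = map (vadd (vopp v) \o vopp) H.
  by apply: eq_map => u /=; rewrite voppD.
have e2 : map (vopp \o vadd (vopp v)) H = map (vadd v \o vopp) H.
  by apply: eq_map => u /=; rewrite voppD voppK.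
rewrite e1 e2 -!catA perm_cat2l perm_catC -!catA perm_cat2l.
by rewrite perm_refl.
Qed.

Lemma full_sums_cons d v K K' :
  perm_eq (full_sums d K) (full_sums d K') ->
  perm_eq (full_sums d (v :: K)) (full_sums d (v :: K')).
Proof. by move=> h; apply: perm_cat; apply: perm_map. Qed.

Lemma full_sums_swap d u v K :
  perm_eq (full_sums d (u :: v :: K)) (full_sums d (v :: u :: K)).
Proof.
rewrite /= !map_cat -!map_comp.
have e a b : map (vadd a \o vadd b) (full_sums d K) =
    map (vadd b \o vadd a) (full_sums d K).
  by apply: eq_map => w /=; rewrite vaddCA.
rewrite (e u v) (e u (vopp v)) (e (vopp u) v) (e (vopp u) (vopp v)).
by rewrite -!catA perm_cat2l !catA perm_cat2r perm_catC.
Qed.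

(** * Merging weighted lists *)

(** A binary tree over the bits of a key, with weights.  A leaf sits where its
    key departs from all others, and keeps the rest of the key; [Extra] stores an
    element at a place where the bits of its key are exhausted. *)
Inductive trie (A : Type) : Type :=
| Empty
| Leaf (path : seq bool) (a : A) (w : N)
| Extra (a : A) (w : N) (t : trie A)
| Branch (l r : trie A).
Arguments Empty {A}.

Fixpoint trie_split (A : Type) (p1 : seq bool) (a1 : A) (w1 : N)
    (p2 : seq bool) (a2 : A) (w2 : N) : trie A :=
  match p1, p2 with
  | b1 :: q1, b2 :: q2 =>
      if b1 then
        if b2 then Branch (trie_split q1 a1 w1 q2 a2 w2) Empty
        else Branch (Leaf q1 a1 w1) (Leaf q2 a2 w2)
      else
        if b2 then Branch (Leaf q2 a2 w2) (Leaf q1 a1 w1)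
        else Branch Empty (trie_split q1 a1 w1 q2 a2 w2)
  | _, _ => Extra a1 w1 (Leaf p2 a2 w2)
  end.

Fixpoint trie_add (A : Type) (eqA : A -> A -> bool)
    (p : seq bool) (a : A) (w : N) (t : trie A) {struct t} : trie A :=
  match t with
  | Empty => Leaf p a w
  | Leaf p2 a2 w2 =>
      if eqA a a2 then Leaf p2 a2 (w + w2)%num
      else trie_split p a w p2 a2 w2
  | Extra a2 w2 t2 =>
      if eqA a a2 then Extra a2 (w + w2)%num t2 else Extra a w t
  | Branch l r =>
      match p with
      | [::] => Extra a w t
      | b :: p' =>
          if b then Branch (trie_add eqA p' a w l) r
          else Branch l (trie_add eqA p' a w r)
      end
  end.

Fixpoint trie_seq (A : Type) (t : trie A) (s : seq (A * N)) : seq (A * N) :=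
  match t with
  | Empty => s
  | Leaf _ a w => (a, w) :: s
  | Extra a w t' => (a, w) :: trie_seq t' s
  | Branch l r => trie_seq l (trie_seq r s)
  end.

Fixpoint trie_sum (A : Type) (h : A -> nat) (t : trie A) : nat :=
  match t with
  | Empty => 0
  | Leaf _ a w => w * h a
  | Extra a w t' => w * h a + trie_sum h t'
  | Branch l r => trie_sum h l + trie_sum h r
  end%N.

Definition weighted_sum (A : Type) (h : A -> nat) (s : seq (A * N)) : nat :=
  (\sum_(aw <- s) nat_of_bin aw.2 * h aw.1)%N.

Lemma weighted_sum_trie A (h : A -> nat) t s :
  weighted_sum h (trie_seq t s) = (trie_sum h t + weighted_sum h s)%N.
Proof.
elim: t s => [|_ a w|a w t ih|l ihl r ihr] s //=.
- by rewrite /weighted_sum big_cons.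
- by rewrite /weighted_sum big_cons -/(weighted_sum h _) ih addnA.
- by rewrite ihl ihr addnA.
Qed.

Lemma trie_sum_split A (h : A -> nat) p1 a1 w1 p2 a2 w2 :
  trie_sum h (trie_split p1 a1 w1 p2 a2 w2) = (w1 * h a1 + w2 * h a2)%N.
Proof.
by elim: p1 p2 => [|[] p1 ih] [|[] p2] //=; rewrite ?ih ?addn0 // addnC.
Qed.

(** The key decides where an element is stored, and elements are merged only
    when they are equal. *)
Lemma trie_sum_add A (h : A -> nat) (eqA : A -> A -> bool) p a w t :
  (forall a b, eqA a b -> a = b) ->
  trie_sum h (trie_add eqA p a w t) = (w * h a + trie_sum h t)%N.
Proof.
move=> heq; elim: t p => [|p2 a2 w2|a2 w2 t ih|l ihl r ihr] p //=.
- by rewrite addn0.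
- case e: (eqA a a2); last by rewrite trie_sum_split.
  by rewrite (heq _ _ e) /= nat_of_binD mulnDl.
- case e: (eqA a a2) => //.
  by rewrite (heq _ _ e) /= nat_of_binD mulnDl addnA.
case: p => [|[] p] //=; rewrite ?ihl ?ihr; last by rewrite addnCA.
by rewrite addnA.
Qed.

Fixpoint trie_all (A : Type) (P : pred A) (t : trie A) : bool :=
  match t with
  | Empty => true
  | Leaf _ a _ => P a
  | Extra a _ t' => P a && trie_all P t'
  | Branch l r => trie_all P l && trie_all P r
  end.

Lemma trie_all_seq A (P : pred A) t (s : seq (A * N)) :
  trie_all P t -> all (fun aw => P aw.1) s ->
  all (fun aw => P aw.1) (trie_seq t s).
Proof.
elim: t s => [|_ a w|a w t ih|l ihl r ihr] s //=; first by move=> -> ->.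
  by case/andP=> -> /= ht /(ih _ ht).
by case/andP=> hl hr /(ihr _ hr) /(ihl _ hl).
Qed.

Lemma trie_all_add A (P : pred A) (eqA : A -> A -> bool) p a w t :
  P a -> trie_all P t -> trie_all P (trie_add eqA p a w t).
Proof.
move=> ha; elim: t p => [|p2 a2 w2|a2 w2 t ih|l ihl r ihr] p //=.
- case: (eqA a a2) => //= h2.
  elim: p p2 => [|[] p ih] [|[] p2] //=; rewrite ?ha ?h2 ?ih //.
- by case: (eqA a a2); rewrite //= ha.
case/andP=> hl hr; case: p => [|[] p] //=; rewrite ?ha ?hl ?hr ?andbT //=.
  exact: ihl.
exact: ihr.
Qed.

Fixpoint eq_vec (u v : vec) : bool :=
  match u, v with
  | [::], [::] => true
  | a :: u', b :: v' => if eq79 a b then eq_vec u' v' else false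
  | _, _ => false
  end.

Lemma eq_vecP u v : eq_vec u v -> u = v.
Proof.
by elim: u v => [|a u ih] [|b v] //=; case: ifP => // /eq79P -> /ih ->.
Qed.

Fixpoint eq_config (K L : config) : bool :=
  match K, L with
  | [::], [::] => true
  | u :: K', v :: L' => if eq_vec u v then eq_config K' L' else false
  | _, _ => false
  end.

Lemma eq_configP K L : eq_config K L -> K = L.
Proof.
by elim: K L => [|u K ih] [|v L] //=; case: ifP => // /eq_vecP -> /ih ->.
Qed.

Fixpoint key_vec (v : vec) (r : seq bool) : seq bool :=
  if v is a :: v' then code79 a ++ key_vec v' r else r.

Fixpoint key_config (K : config) : seq bool :=
  if K is v :: K' then key_vec v (key_config K') else [::].

(** * The lines met by the signed sums *)

Definition points_trie (s : seq vec) : trie vec :=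
  foldl (fun t v =>
           if nonzero v then
             let v' := normalize v in
             trie_add eq_vec (key_vec v' [::]) v' 1%num t
           else t) Empty s.

(** The lines spanned by the nonzero signed sums, each by a vector with first
    nonzero coordinate 1 and with the number of half sums on it. *)
Definition points (K : config) : seq (vec * N) :=
  trie_seq (points_trie (half_sums K)) [::].

Definition projective_point (d : nat) (v : vec) : bool := of_size d v && nonzero v.

Lemma points_ok d K : all (of_size d) K ->
  all (fun pm => projective_point d pm.1) (points K).
Proof.
move=> hK; apply: trie_all_seq => //.
have hs : all (of_size d) (half_sums K).
  elim: K hK => //= v K ih /andP[/eqP hv /ih hs].
  case: K {ih} hs => [_|w K hs]; first by rewrite /= /of_size hv eqxx.
  rewrite all_cat !all_map; apply/andP; split; apply: sub_all hs => u /eqP eu;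
    by rewrite /= /of_size size_vadd ?size_map eu hv minnn.
rewrite /points_trie; have : trie_all (projective_point d) Empty by [].
elim: (half_sums K) hs (Empty) => //= v s ih /andP[/eqP hv hs] t ht.
apply: ih => //; case: ifP => // nv; apply: trie_all_add => //.
have [c hc ->] := normalizeE nv.
by rewrite /projective_point nonzero_scale // nv /of_size size_vscale hv eqxx.
Qed.

Lemma weighted_sum_points (h : vec -> nat) K :
  (forall v, ~~ nonzero v -> h v = 0%N) ->
  (forall c v, c != 0 -> h (vscale c v) = h v) ->
  weighted_sum h (points K) = (\sum_(v <- half_sums K) h v)%N.
Proof.
move=> h0 hZ; rewrite /points weighted_sum_trie /weighted_sum big_nil addn0.
rewrite /points_trie -[RHS]addn0 -[X in (_ + X)%N]/(trie_sum h Empty).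
elim: (half_sums K) (Empty) => [|v s ih] t /=; first by rewrite big_nil.
rewrite ih big_cons; case: ifP => nv; last by rewrite h0 ?nv.
rewrite trie_sum_add; last exact: eq_vecP.
have [c hc ->] := normalizeE nv.
by rewrite hZ // mul1n addnCA addnA.
Qed.

(** * Normal forms of configurations *)

(** The matrix G of scalar products of the rows of a configuration K defines the
    projection K^T G^-1 K onto its row space (if G is invertible).  Its entries are
    unchanged when an invertible linear map is applied to K, and are permuted and
    multiplied by signs along with the vectors of K.  They are thus used to select a
    basis among the vectors of K: at each stage the column with the largest key,
    where a key lists the absolute values of its entries against the columns already
    chosen, followed by its diagonal entry (its leverage).  Expressing all vectors in
    that basis, fixing signs and sorting gives the normal form. *)

Fixpoint dot (u v : vec) (s : F79) : F79 :=
  match u, v with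
  | a :: u', b :: v' => dot u' v' (add79 s (mul79 a b))
  | _, _ => s
  end.

Fixpoint mat_add (M N : seq vec) : seq vec :=
  match M, N with
  | u :: M', v :: N' => vadd u v :: mat_add M' N'
  | _, _ => [::]
  end.

Definition outer (c : vec) : seq vec := map (fun a => vscale a c) c.

Definition gram (K : config) : seq vec :=
  if K is c :: K' then foldl (fun M c => mat_add M (outer c)) (outer c) K'
  else [::].

(** Gauss-Jordan elimination: pivoting on the columns of G turns K into G^-1 K. *)
Fixpoint eliminate (n : nat) (G K : seq vec) : seq vec :=
  match n, G with
  | n'.+1, g :: G' => eliminate n' (map (pivot g) G') (map (pivot g) K)
  | _, _ => K
  end.

(** The vector of K in the current and in the initial coordinates, its column
    of G^-1 K, and the data by which columns are compared. *)
Record column : Type := Column {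
  current : vec;
  keys : seq F79;
  leverage : F79;
  source : vec;
  covector : vec }.

Fixpoint columns (K L : seq vec) : seq column :=
  match K, L with
  | k :: K', l :: L' => Column k [::] (dot k l f0) k l :: columns K' L'
  | _, _ => [::]
  end.

Fixpoint key_lt (u v : seq F79) (x y : F79) : bool :=
  match u, v with
  | a :: u', b :: v' =>
      match cmp79 a b with
      | Lt => true
      | Gt => false
      | Eq => key_lt u' v' x y
      end
  | _, _ => if cmp79 x y is Lt then true else false
  end.

(** The last coordinates of a current vector are those along the basis vectors
    already chosen; a column is independent of these when one of the first n
    coordinates is nonzero. *)
Fixpoint best (n : nat) (s : seq column) (b : option column) : option column :=
  match s with
  | [::] => b
  | c :: s' =>
      if nonzero (take n (current c)) then
        match b with
        | None => best n s' (Some c)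
        | Some c' =>
            if key_lt (keys c') (keys c) (leverage c') (leverage c)
            then best n s' (Some c) else best n s' b
        end
      else best n s' b
  end.

(** The sign of a basis vector is chosen such that its first nonzero entry
    against an earlier basis vector becomes small (at most 39). *)
Fixpoint row_sign (k : vec) (chosen : seq (vec * bool)) : bool :=
  match chosen with
  | [::] => true
  | (l, s) :: chosen' =>
      let x := dot k l f0 in
      if is_f0 x then row_sign k chosen'
      else if small79 x then s else ~~ s
  end.

Definition update (p b : vec) (c : column) : column :=
  match c with
  | Column v ks x k l =>
      Column (pivot p v) (rcons ks (abs79 (dot b l f0))) x k l
  end.

Fixpoint reduce (n : nat) (s : seq column) (chosen : seq (vec * bool)) :
    seq column :=
  match n with
  | 0%N => s
  | n'.+1 =>
      match best n s None with
      | None => s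
      | Some b =>
          let sg := row_sign (source b) chosen in
          let p := if sg then current b else vopp (current b) in
          if nonzero p then
            reduce n' (map (update p (source b)) s)
              (rcons chosen (covector b, sg))
          else s
      end
  end.

Fixpoint leads_small (v : vec) : bool :=
  if v is a :: v' then if is_f0 a then leads_small v' else small79 a else true.

Definition sign_normalize (v : vec) : vec := if leads_small v then v else vopp v.

Fixpoint vec_gt (u v : vec) : bool :=
  match u, v with
  | a :: u', b :: v' =>
      match cmp79 a b with
      | Eq => vec_gt u' v'
      | Gt => true
      | Lt => false
      end
  | _, _ => false
  end.

Fixpoint insert (v : vec) (K : config) : config :=
  if K is u :: K' then if vec_gt v u then u :: insert v K' else v :: K
  else [:: v].

Definition normal_form (K : config) : config :=
  let d := size (head [::] K) in
  let L := eliminate d (gram K) K in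
  foldr insert [::]
    (map (fun c => sign_normalize (current c)) (reduce d (columns K L) [::])).

Lemma full_sums_insert d v K :
  perm_eq (full_sums d (insert v K)) (full_sums d (v :: K)).
Proof.
elim: K => [|u K ih] //=; case: ifP => _ //.
apply: perm_trans (full_sums_swap d u v K).
exact: full_sums_cons.
Qed.

Lemma full_sums_sort d K :
  perm_eq (full_sums d (foldr insert [::] K)) (full_sums d K).
Proof.
elim: K => //= v K ih; apply: perm_trans (full_sums_insert d v _) _.
exact: full_sums_cons.
Qed.

Lemma full_sums_sign d K :
  perm_eq (full_sums d (map sign_normalize K)) (full_sums d K).
Proof.
elim: K => // v K ih; rewrite map_cons.
apply: perm_trans (full_sums_cons _ ih) _.
rewrite /sign_normalize; case: ifP => // _.
by rewrite /= voppK perm_catC.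
Qed.

Lemma pivot_linear d p : size p = d -> nonzero p -> injective_linear d (pivot p).
Proof.
move=> ep hp; have d0 : (0 < d)%N by case: p ep hp => // a p <-.
have aux u v a b : size u = size v ->
    vadd (rcons u a) (rcons v b) = rcons (vadd u v) (add79 a b).
  by elim: u v => [|x u ih] [|y v] //= [e]; rewrite ih.
split=> [v ev|u v eu ev|c v ev|v ev].
- by rewrite size_rcons size_quot ?ep ?ev ?prednK.
- by rewrite /pivot aux ?quotD ?coefD ?size_quot ?ep ?eu ?ev.
- by rewrite /pivot /vscale map_rcons -/(vscale c _) quotZ coefZ.
rewrite /pivot => h.
have nz_rcons u a : nonzero (rcons u a) = nonzero u || ~~ is_f0 a.
  by elim: u => [|x u ih] /=; [case: is_f0 | rewrite ih; case: is_f0].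
move: h; rewrite nz_rcons negb_or negbK is_f0E => /andP[hq /eqP hc].
by rewrite (quot_eq0 _ hp hq) ?ep // hc vscale0 nonzero_nseq.
Qed.

Lemma all_best (P : pred column) n s b c :
  all P s -> (forall c', b = Some c' -> P c') -> best n s b = Some c -> P c.
Proof.
elim: s b => [|x s ih] b /= => [_ hb /hb //|/andP[hx hs] hb].
have hx' c' : Some x = Some c' -> P c' by case=> <-.
case: ifP => _; last exact: ih.
by case: b hb => [c'|] hb; [case: ifP => _|]; apply: ih.
Qed.

Lemma map_update p b s :
  map current (map (update p b) s) = map (pivot p) (map current s).
Proof. by elim: s => //= -[v ks x k l] s ->. Qed.

(** Each stage is one invertible change of coordinates, for whichever nonzero
    vector it pivots on. *)
Lemma reduce_spec d n s chosen : all (of_size d) (map current s) ->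
  all (of_size d) (map current (reduce n s chosen)) /\
  forall m, count_indep m (full_sums d (map current (reduce n s chosen))) =
            count_indep m (full_sums d (map current s)).
Proof.
elim: n s chosen => //= n ih s chosen hs.
case hb : (best _ _ _) => [b|] //.
set p := if row_sign (source b) chosen then current b else vopp (current b).
case: ifP => // hp.
have ep : size p = d.
  have eb : size (current b) = d.
    by apply/eqP; rewrite all_map in hs; apply: all_best hs _ hb.
  by rewrite /p; case: ifP; rewrite ?size_map.
have hl := pivot_linear ep hp.
have [|h1 h2] := ih (map (update p (source b)) s)
  (rcons chosen (covector b, row_sign (source b) chosen)).
  by rewrite map_update; apply: all_size_map.
split=> // m; rewrite h2 map_update full_sums_linear //.
exact: count_indep_map hl (all_size_full hs).
Qed.

Lemma size_eliminate n G K : size (eliminate n G K) = size K.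
Proof. by elim: n G K => [|n ih] [|g G] K //=; rewrite ih size_map. Qed.

Lemma map_current_columns K L :
  size L = size K -> map current (columns K L) = K.
Proof. by elim: K L => [|k K ih] [|l L] //= [/ih ->]. Qed.

Lemma count_indep_normal_form d m K : all (of_size d) K ->
  count_indep m (full_sums d (normal_form K)) = count_indep m (full_sums d K).
Proof.
move=> hK; rewrite /normal_form.
rewrite (count_indep_perm _ (full_sums_sort d _)).
set s := columns _ _; have es : map current s = K.
  by apply: map_current_columns; rewrite size_eliminate.
rewrite (map_comp sign_normalize current) (count_indep_perm _ (full_sums_sign d _)).
have [|_ ->] := @reduce_spec d (size (head [::] K)) s [::]; by rewrite es.
Qed.

(** * One step of the recursion *)

Definition absorb_config (t : trie config) (K : config) (w : N) : trie config :=
  foldl (fun t pm =>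
           let L := normal_form (map (quot pm.1) K) in
           trie_add eq_config (key_config L) L (pm.2 * w)%num t)
    t (points K).

Definition level_trie (l : level) : trie config :=
  foldl (fun t Kw => trie_add eq_config (key_config Kw.1) Kw.1 Kw.2 t) Empty l.

(** Adds the normal forms of all quotients of the configurations of l to those
    of acc, which allows a large level to be processed in portions. *)
Definition absorb (acc l : level) : level :=
  trie_seq
    (foldl (fun t Kw => absorb_config t Kw.1 Kw.2) (level_trie acc) l) [::].

Definition level_count (d : nat) (l : level) : nat :=
  weighted_sum (fun K => count_indep d (full_sums d K)) l.

Definition proper_config (d : nat) (K : config) : bool :=
  all (of_size d) K && (0 < size K)%N.

Lemma count_indep_full d m K : proper_config d K ->
  count_indep m.+1 (full_sums d K) =
  (2 * \sum_(v <- half_sums K)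
     if nonzero v then count_indep m (map (quot v) (full_sums d K)) else 0)%N.
Proof.
case/andP=> hK; rewrite lt0n size_eq0 => K0 /=.
rewrite (perm_big _ (full_sums_half hK K0)) /= big_cat big_map /=.
rewrite mul2n -addnn -big_mkcond; congr (_ + _)%N.
apply: eq_big => v; first by rewrite nonzero_opp.
by move=> _; congr count_indep; apply: eq_map => w; rewrite quot_opp.
Qed.

Lemma trie_sum_absorb_config d t K w : proper_config d.+1 K ->
  (2 * trie_sum (fun L => count_indep d (full_sums d L)) (absorb_config t K w) =
   2 * trie_sum (fun L => count_indep d (full_sums d L)) t
   + w * count_indep d.+1 (full_sums d.+1 K))%N.
Proof.
move=> hK; rewrite count_indep_full //.
pose h (v : vec) := if nonzero v
  then count_indep d (map (quot v) (full_sums d.+1 K)) else 0%N.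
rewrite -[X in (w * (_ * X))%N]/(\sum_(v <- half_sums K) h v)%N.
have hpts := points_ok (proj1 (andP hK)).
rewrite -(@weighted_sum_points h); last 2 first.
- by move=> v; rewrite /h => /negPf ->.
- move=> c v hc; rewrite /h nonzero_scale //; case: ifP => // _.
  by congr count_indep; apply: eq_map => u; rewrite quot_scale.
rewrite mulnCA -mulnDr; congr (2 * _)%N.
rewrite /absorb_config /weighted_sum; elim: (points K) t hpts => [|[p m] s ih] t /=.
  by rewrite big_nil muln0 addn0.
case/andP=> /andP[/eqP ep hp] hs; rewrite ih // big_cons mulnDr /=.
rewrite trie_sum_add; last exact: eq_configP.
rewrite count_indep_normal_form; last first.
  by apply: all_size_quot; rewrite // (proj1 (andP hK)).
rewrite full_sums_quot ?(proj1 (andP hK)) // /h hp nat_of_binM.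
by rewrite addnA (addnC (_ * _)%N) mulnA (mulnC m).
Qed.

Lemma trie_sum_level (h : config -> nat) l :
  trie_sum h (level_trie l) = weighted_sum h l.
Proof.
rewrite /level_trie -[RHS]addn0 -[X in (_ + X)%N]/(trie_sum h Empty).
rewrite /weighted_sum; elim: l (Empty) => [|[K w] l ih] t /=; first by rewrite big_nil.
rewrite ih big_cons trie_sum_add; last exact: eq_configP.
by rewrite addnCA addnA.
Qed.

(** The factors 2 account for the signed sums and their opposites, which span
    the same lines. *)
Lemma level_count_absorb d acc l :
  all (fun Kw => proper_config d.+1 Kw.1) l ->
  (2 * level_count d (absorb acc l) = 2 * level_count d acc + level_count d.+1 l)%N.
Proof.
rewrite /level_count /absorb weighted_sum_trie => hl.
rewrite [weighted_sum _ [::]]big_nil addn0 -(trie_sum_level _ acc).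
rewrite /weighted_sum; elim: l (level_trie acc) hl => [|[K w] l ih] t /=.
  by rewrite big_nil addn0.
case/andP=> hK hl; rewrite ih // trie_sum_absorb_config // big_cons /=.
by rewrite addnA.
Qed.

Fixpoint eq_level (l m : level) : bool :=
  match l, m with
  | [::], [::] => true
  | (K, w) :: l', (L, x) :: m' =>
      if eq_config K L then if N.eqb w x then eq_level l' m' else false
      else false
  | _, _ => false
  end.

Lemma eq_levelP l m : eq_level l m -> l = m.
Proof.
elim: l m => [|[K w] l ih] [|[L x] m] //=.
by case: ifP => // /eq_configP ->; case: ifP => // /N.eqb_eq -> /ih ->.
Qed.

(** * Independent triples in dimension three *)

(** Numbers attached to binary keys, for counting how often each slope occurs. *)
Inductive tree : Type := Tip | Node (l : tree) (n : N) (r : tree).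

Fixpoint tree_add (k : positive) (m : N) (t : tree) : tree :=
  match t, k with
  | Tip, xH => Node Tip m Tip
  | Tip, xO k' => Node (tree_add k' m Tip) 0%num Tip
  | Tip, xI k' => Node Tip 0%num (tree_add k' m Tip)
  | Node l n r, xH => Node l (n + m)%num r
  | Node l n r, xO k' => Node (tree_add k' m l) n r
  | Node l n r, xI k' => Node l n (tree_add k' m r)
  end.

(** Most slopes occur only a few times, so the small squares are listed. *)
Definition square (n : N) : N :=
  match n with
  | 0 => 0
  | 1 => 1
  | 2 => 4
  | 3 => 9
  | _ => n * n
  end%num.

Fixpoint sum_squares (t : tree) (s : N) : N :=
  if t is Node l n r then sum_squares l (sum_squares r (square n + s)%num)
  else s.

Definition tally (key : vec * N -> positive) (l : seq (vec * N)) : tree :=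
  foldr (fun qm t => tree_add (key qm) qm.2 t) Tip l.

Fixpoint tree_get (k : positive) (t : tree) {struct t} : nat :=
  if t is Node l n r then
    match k with
    | xH => n
    | xO k' => tree_get k' l
    | xI k' => tree_get k' r
    end
  else 0%N.

Fixpoint tree_squares (t : tree) : nat :=
  if t is Node l n r then (tree_squares l + (tree_squares r + n * n))%N else 0%N.

Lemma squareE n : nat_of_bin (square n) = (n * n)%N.
Proof. by case: n => [|[[p|p|]|[p|p|]|]] //; rewrite -nat_of_binM. Qed.

Lemma sum_squaresE t s :
  nat_of_bin (sum_squares t s) = (tree_squares t + s)%N.
Proof.
elim: t s => //= l ihl n r ihr s.
by rewrite ihl ihr nat_of_binD squareE !addnA.
Qed.

Lemma tree_get_add k k' m t :
  tree_get k (tree_add k' m t) = ((if Pos.eqb k k' then m : nat else 0) + tree_get k t)%N.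
Proof.
elim: k' k t => [k' ih|k' ih|] [k|k|] [|l n r] //=; rewrite ?ih /= ?addn0 //.
by rewrite nat_of_binD addnC.
Qed.

Lemma tree_squares_add k m t :
  tree_squares (tree_add k m t) =
  (m * m + 2 * (m * tree_get k t) + tree_squares t)%N.
Proof.
elim: k t => [k ih|k ih|] [|l n r] //=; rewrite ?ih ?nat_of_binD //=; try nia.
Qed.

Lemma tree_get_tally key k l :
  tree_get k (tally key l) = (\sum_(b <- l) if Pos.eqb k (key b) then b.2 : nat else 0)%N.
Proof.
by elim: l => [|b l ih] /=; rewrite ?big_nil // big_cons tree_get_add ih.
Qed.

Lemma tree_squares_tally key l :
  tree_squares (tally key l) =
  (\sum_(b <- l) \sum_(c <- l) if Pos.eqb (key b) (key c) then b.2 * c.2 else 0)%N.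
Proof.
elim: l => [|b l ih] /=; first by rewrite big_nil.
rewrite tree_squares_add ih big_cons big_cons Pos.eqb_refl tree_get_tally.
under [X in (_ = _ + X)%N]eq_bigr => c _ do rewrite big_cons.
rewrite big_split /= big_distrr /=.
have -> : (\sum_(c <- l) (if Pos.eqb (key c) (key b) then c.2 * b.2 else 0) =
           \sum_(c <- l) (if Pos.eqb (key b) (key c) then b.2 * c.2 else 0))%N.
  by apply: eq_bigr => c _; rewrite Pos.eqb_sym mulnC.
have -> : (\sum_(c <- l) b.2 * (if Pos.eqb (key b) (key c) then c.2 : nat else 0) =
           \sum_(c <- l) (if Pos.eqb (key b) (key c) then b.2 * c.2 else 0))%N.
  by apply: eq_bigr => c _; case: ifP => // _; rewrite muln0.
by rewrite mul2n -addnn !addnA.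
Qed.

(** The key 1 is reserved for vectors that vanish in the quotient. *)
Definition distinct_keys (j k : positive) : bool :=
  [&& ~~ Pos.eqb j 1, ~~ Pos.eqb k 1 & ~~ Pos.eqb j k].

Lemma sum_distinct_keys (key : vec * N -> positive) (l : seq (vec * N)) :
  let t := tally key l in
  let z := tree_get 1 t in
  let s := (\sum_(b <- l) (b.2 : nat))%N in
  ((\sum_(b <- l) \sum_(c <- l)
     (if distinct_keys (key b) (key c) then b.2 * c.2 else 0)) + tree_squares t =
  (s - z) * (s - z) + z * z)%N.
Proof.
move=> t z s; rewrite tree_squares_tally -big_split /=.
pose f (b : vec * N) : nat := if Pos.eqb 1 (key b) then b.2 : nat else 0%N.
pose g (b : vec * N) : nat := if Pos.eqb 1 (key b) then 0%N else b.2 : nat.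
have ez : z = (\sum_(b <- l) f b)%N by rewrite /z tree_get_tally.
have es : (s - z = \sum_(b <- l) g b)%N.
  have -> : s = (\sum_(b <- l) g b + z)%N.
    rewrite ez -big_split; apply: eq_bigr => b _ /=.
    by rewrite /f /g; case: (Pos.eqb _ _); rewrite ?addn0.
  by rewrite addnK.
rewrite es ez !big_distrlr /= -big_split; apply: eq_bigr => b _.
rewrite -!big_split; apply: eq_bigr => c _; rewrite /f /g /distinct_keys.
rewrite !(Pos.eqb_sym 1).
case: (Pos.eqb_spec (key b) 1) => hb; case: (Pos.eqb_spec (key c) 1) => hc;
  case: (Pos.eqb_spec (key b) (key c)) => hbc /=;
  rewrite ?mul0n ?muln0 ?addn0 ?add0n //; exfalso; congruence.
Qed.

(** A vector of the quotient plane determines a point of the projective line;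
    the keys are 3 for the point at infinity, even numbers for the finite slopes,
    and 1 for the zero vector. *)
Definition slope (v : vec) : positive :=
  match v with
  | [:: a; b] =>
      if is_f0 a then if is_f0 b then 1%positive else 3%positive
      else xO (index79 (mul79 b (inv79 a)))
  | _ => 1%positive
  end.

Definition slopes (p : vec) (l : seq (vec * N)) : tree :=
  tally (fun qm => slope (quot p qm.1)) l.

Definition parallel_weight (t : tree) : N := if t is Node _ n _ then n else 0%num.

(** The total weight of l, and twice the weight of its unordered independent
    triples.  Each triple is counted at its first point p, once for each order of
    the other two: of the later points, with total weight s, those of weight z lie
    on the line of p, and among the (s - z)^2 pairs of remaining ones those with
    equal slopes are discarded.  The sum of squares also contains z^2, the square
    for the key 1. *)
Fixpoint triangles (l : seq (vec * N)) : N * N :=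
  match l with
  | [::] => (0, 0)
  | (p, m) :: l' =>
      let (s, n) := triangles l' in
      let t := slopes p l' in
      let z := parallel_weight t in
      (s + m, n + m * ((s - z) * (s - z) + z * z - sum_squares t 0))
  end%num.

Definition count3 (l : level) : N :=
  foldl (fun s Kw => (s + Kw.2 * (triangles (points Kw.1)).2)%num) 0%num l.

Definition noncoplanar (u v w : vec) : bool :=
  [&& nonzero u, nonzero (quot u v) & nonzero (quot (quot u v) (quot u w))].

Lemma noncoplanarE u v w : noncoplanar u v w = indep 3 [:: u; v; w].
Proof. by rewrite /= andbT. Qed.

Lemma noncoplanar_swap12 u v w : all (of_size 3) [:: u; v; w] ->
  noncoplanar u v w = noncoplanar v u w.
Proof. by rewrite !noncoplanarE; apply: (@indep_swap 3 u v [:: w]). Qed.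

Lemma noncoplanar_swap23 u v w : all (of_size 3) [:: u; v; w] ->
  noncoplanar u v w = noncoplanar u w v.
Proof.
rewrite /noncoplanar => /and4P[/eqP eu ev ew _].
case hu : (nonzero u) => //=.
have hq := all_size_quot eu hu (_ : all (of_size 3) [:: v; w]).
rewrite -[LHS]andbT -[RHS]andbT -!andbA.
by apply: (@indep_swap 2 (quot u v) (quot u w) [::]); apply: hq; rewrite /= ev ew.
Qed.

Lemma noncoplanar_eq12 u w : noncoplanar u u w = false.
Proof. by rewrite /noncoplanar; case hu : (nonzero u); rewrite //= quot_id. Qed.

Lemma noncoplanar_eq23 u v : noncoplanar u v v = false.
Proof.
rewrite /noncoplanar; case: (nonzero u) => //=.
by case h : (nonzero (quot u v)); rewrite //= quot_id.
Qed.

Lemma noncoplanar_eq13 u v : all (of_size 3) [:: u; v] -> noncoplanar u v u = false.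
Proof.
move=> /and3P[hu hv _]; rewrite noncoplanar_swap23 ?noncoplanar_eq12 //=.
by rewrite hu hv.
Qed.

Lemma slope_eq1 u : of_size 2 u -> nonzero u = ~~ Pos.eqb (slope u) 1.
Proof.
case: u => [|a [|b [|? ?]]] //= _.
by rewrite !is_f0E; case: eqVneq => _ //; case: eqVneq.
Qed.

Lemma slope_distinct u v : of_size 2 u -> of_size 2 v ->
  nonzero u && nonzero (quot u v) = distinct_keys (slope u) (slope v).
Proof.
move=> hu hv; rewrite slope_eq1 // /distinct_keys; case hs : (Pos.eqb _ _) => //=.
move: hs; case: u v hu hv => [|a [|b [|? ?]]] // [|c [|e [|? ?]]] // _ _ /=.
rewrite !is_f0E; case: (eqVneq a 0) => [_|ha] /=.
  case: (eqVneq b 0) => [//|hb _] /=.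
  by rewrite is_f0E; case: (eqVneq c 0) => //= _; case: (eqVneq e 0).
move=> _; rewrite !is_f0E !(add79E, mul79E, opp79E, inv79E).
case: (eqVneq c 0) => [->|hc] /=.
  by rewrite mul0r oppr0 mul0r addr0; case: (eqVneq e 0).
rewrite index79_eq; have -> : (e + - (c / a) * b == 0) = (b / a == e / c).
  have -> : e + - (c / a) * b = (e / c - b / a) * c.
    by rewrite mulrBl divfK // mulNr mulrAC -(mulrA b) (mulrC _ c) mulrA (mulrC b).
  by rewrite mulf_eq0 (negPf hc) orbF subr_eq0 eq_sym.
by case: (b / a == e / c).
Qed.

Lemma noncoplanar_slope u v w : all (of_size 3) [:: u; v; w] -> nonzero u ->
  noncoplanar u v w = distinct_keys (slope (quot u v)) (slope (quot u w)).
Proof.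
move=> /= /and4P[/eqP eu ev ew _] hu; rewrite /noncoplanar hu /=.
have := all_size_quot eu hu (_ : all (of_size 3) [:: v; w]).
by rewrite /= ev ew => /(_ isT) /and3P[hv hw _]; apply: slope_distinct.
Qed.

Definition triple_sum (l : seq (vec * N)) : nat :=
  (\sum_(a <- l) \sum_(b <- l) \sum_(c <- l)
    if noncoplanar a.1 b.1 c.1 then a.2 * b.2 * c.2 else 0)%N.

(** A new point x occurs exactly once in a noncoplanar triple containing it, in
    one of three positions. *)
Lemma triple_sum_cons x l :
  all (fun pm => projective_point 3 pm.1) (x :: l) ->
  triple_sum (x :: l) =
  (triple_sum l + 3 * \sum_(b <- l) \sum_(c <- l)
     if noncoplanar x.1 b.1 c.1 then x.2 * b.2 * c.2 else 0)%N.
Proof.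
move=> hxl.
have sz a : a \in x :: l -> of_size 3 a.1 by move/(allP hxl)/andP=> [].
pose F (a b c : vec * N) : nat :=
  if noncoplanar a.1 b.1 c.1 then (a.2 * b.2 * c.2)%N else 0%N.
have Fxx c : F x x c = 0%N by rewrite /F noncoplanar_eq12.
have Faxx a : F a x x = 0%N by rewrite /F noncoplanar_eq23.
have hx : x \in x :: l by rewrite mem_head.
have hl a : a \in l -> a \in x :: l by rewrite in_cons orbC => ->.
have Fxbx b : b \in l -> F x b x = 0%N.
  by move=> /hl hb; rewrite /F noncoplanar_eq13 //= !sz.
have F12 a c : a \in l -> c \in l -> F a x c = F x a c.
  move=> /hl ha /hl hc; rewrite /F noncoplanar_swap12 /= ?sz //.
  by rewrite (mulnC a.2).
have F23 a b : a \in l -> b \in l -> F a b x = F x a b.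
  move=> ha hb; rewrite -(F12 a b) // /F noncoplanar_swap23 /= ?sz ?hx ?hl //.
  by rewrite mulnAC.
change (\sum_(a <- x :: l) \sum_(b <- x :: l) \sum_(c <- x :: l) F a b c =
  \sum_(a <- l) \sum_(b <- l) \sum_(c <- l) F a b c
  + 3 * \sum_(b <- l) \sum_(c <- l) F x b c)%N.
set T := (\sum_(b <- l) \sum_(c <- l) F x b c)%N.
have e1 : (\sum_(b <- x :: l) \sum_(c <- x :: l) F x b c = T)%N.
  rewrite big_cons big1_seq ?add0n => [|c _]; last by rewrite Fxx.
  by apply: eq_big_seq => b hb; rewrite big_cons Fxbx.
have e2 : (\sum_(a <- l) \sum_(b <- x :: l) \sum_(c <- x :: l) F a b c =
           T + (T + \sum_(a <- l) \sum_(b <- l) \sum_(c <- l) F a b c))%N.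
  rewrite -!big_split; apply: eq_big_seq => a ha /=.
  rewrite big_cons big_cons Faxx add0n; congr (_ + _)%N.
    by apply: eq_big_seq => c hc; rewrite F12.
  rewrite -big_split; apply: eq_big_seq => b hb /=.
  by rewrite big_cons F23.
by rewrite big_cons e1 e2; lia.
Qed.

Lemma trianglesE l : all (fun pm => projective_point 3 pm.1) l ->
  nat_of_bin (triangles l).1 = (\sum_(b <- l) (b.2 : nat))%N /\
  triple_sum l = (3 * (triangles l).2)%N.
Proof.
elim: l => [|[p m] l ih] hl; first by rewrite /triple_sum !big_nil.
have [h1 h2] := ih (proj2 (andP hl)).
rewrite triple_sum_cons // big_cons h2 /=.
move: h1 {h2 ih}; case: (triangles l) => s n /= h1.
rewrite nat_of_binD h1 addnC; split=> //.
rewrite nat_of_binD mulnDr nat_of_binM; congr (_ + 3 * _)%N.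
pose key (b : vec * N) := slope (quot p b.1).
have [/andP[hp np] hl'] := andP hl.
have h := sum_distinct_keys key l.
rewrite -/(slopes p l) /= in h; set t := slopes p l in h *.
have er : nat_of_bin (parallel_weight t) = tree_get 1 t by case: (t).
set s' := (\sum_(b <- l) (b.2 : nat))%N in h h1.
have hz : (tree_get 1 t <= s')%N.
  rewrite /t tree_get_tally; apply: leq_sum => b _.
  by case: Pos.eqb.
have esz : nat_of_bin (s - parallel_weight t)%num = (s' - tree_get 1 t)%N.
  by apply: nat_of_bin_sub; rewrite er subnK.
rewrite (@nat_of_bin_sub _ _
  (\sum_(b <- l) \sum_(c <- l)
     if distinct_keys (key b) (key c) then b.2 * c.2 else 0)%N); last first.
  by rewrite nat_of_binD !nat_of_binM sum_squaresE addn0 esz er h.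
rewrite big_distrr /=; apply: eq_big_seq => b hb.
rewrite big_distrr /=; apply: eq_big_seq => c hc.
rewrite noncoplanar_slope //=; first by case: ifP; rewrite ?muln0 ?mulnA.
by rewrite hp; have /andP[-> _] := allP hl' _ hb; have /andP[-> _] := allP hl' _ hc.
Qed.

Lemma count_indep3 s :
  count_indep 3 s =
  (\sum_(u <- s) \sum_(v <- s) \sum_(w <- s) noncoplanar u v w)%N.
Proof.
rewrite /= big_mkcond; apply: eq_bigr => u _; rewrite /noncoplanar.
case: ifP => hu; last by rewrite big1 // => v _; rewrite big1.
rewrite big_map big_mkcond; apply: eq_bigr => v _.
case: ifP => hv /=; last by rewrite big1.
by rewrite !big_map big_mkcond; apply: eq_bigr => w _; case: ifP.
Qed.

(** 24 = 2^3 * 3: the signs of three vectors, and the factor of [trianglesE]. *)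
Lemma count_indep_planar K : proper_config 3 K ->
  count_indep 3 (full_sums 3 K) = (24 * (triangles (points K)).2)%N.
Proof.
move=> /andP[hK]; rewrite lt0n size_eq0 => K0.
have hpts := points_ok hK.
rewrite (count_indep_perm _ (full_sums_half hK K0)).
have hs : all (of_size 3) (half_sums K).
  have := all_size_full hK; rewrite (perm_all _ (full_sums_half hK K0)).
  by rewrite all_cat => /andP[].
rewrite (@count_indep_sym 3) // -[24%N]/(2 ^ 3 * 3)%N -mulnA; congr (_ * _)%N.
have [_ <-] := trianglesE hpts; rewrite count_indep3.
have nzZ c v : c != 0 -> nonzero (vscale c v) = nonzero v := @nonzero_scale c v.
have ncZ1 c u v w : c != 0 -> noncoplanar (vscale c u) v w = noncoplanar u v w.
  by move=> hc; rewrite /noncoplanar nzZ // !(quot_scale _ _ hc).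
have ncZ2 c u v w : c != 0 -> noncoplanar u (vscale c v) w = noncoplanar u v w.
  by move=> hc; rewrite /noncoplanar quotZ nzZ // quot_scale.
have ncZ3 c u v w : c != 0 -> noncoplanar u v (vscale c w) = noncoplanar u v w.
  by move=> hc; rewrite /noncoplanar !quotZ nzZ.
have z0 c (v : vec) : ~~ nonzero v -> vscale c v = v.
  by move=> /(nonzeroPn (erefl _)) ->; rewrite vscaler0.
have quot00 p v : ~~ nonzero v -> nonzero (quot p v) = false.
  move=> hv; have : vscale 0 v = v by apply: z0.
  by move=> <-; rewrite quotZ vscale0 nonzero_nseq.
have nc1 u v w : ~~ nonzero u -> noncoplanar u v w = false.
  by rewrite /noncoplanar => /negPf ->.
have nc2 u v w : ~~ nonzero v -> noncoplanar u v w = false.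
  by move=> hv; rewrite /noncoplanar (quot00 u v hv) andbF.
have nc3 u v w : ~~ nonzero w -> noncoplanar u v w = false.
  by move=> hw; rewrite /noncoplanar [X in _ && X]andbC quot00 ?andbF // quot00.
rewrite -weighted_sum_points; last 2 first.
- by move=> u hu; rewrite big1 // => v _; rewrite big1 // => w _; rewrite nc1.
- by move=> c u hc; apply: eq_bigr => v _; apply: eq_bigr => w _; rewrite ncZ1.
apply: eq_bigr => a _.
rewrite -weighted_sum_points; last 2 first.
- by move=> u hu; rewrite big1 // => w _; rewrite nc2.
- by move=> c u hc; apply: eq_bigr => w _; rewrite ncZ2.
rewrite /weighted_sum big_distrr /=; apply: eq_bigr => b _.
rewrite -weighted_sum_points; last 2 first.
- by move=> u hu; rewrite nc3.
- by move=> c u hc; rewrite ncZ3.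
rewrite /weighted_sum !big_distrr /=; apply: eq_bigr => c _.
by case: noncoplanar; rewrite ?muln0 ?muln1 // mulnA.
Qed.

Lemma level_count3 l :
  all (fun Kw => proper_config 3 Kw.1) l -> level_count 3 l = (24 * count3 l)%N.
Proof.
rewrite /level_count /weighted_sum /count3 => hl.
suff h s : nat_of_bin (foldl (fun s Kw =>
      (s + Kw.2 * (triangles (points Kw.1)).2)%num) s l) =
    (s + \sum_(Kw <- l) Kw.2 * (triangles (points Kw.1)).2)%N.
  rewrite h add0n big_distrr; apply: eq_big_seq => Kw /(allP hl) hK.
  by rewrite count_indep_planar // mulnCA.
elim: l s {hl} => [|[K w] l ih] s /=; first by rewrite big_nil addn0.
by rewrite ih big_cons nat_of_binD nat_of_binM addnA.
Qed.

(** * Hadamard's inequality *)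

Lemma gram_row_ge0 (R : realFieldType) n (u : 'rV[R]_n) : 0 <= (u *m u^T) 0 0.
Proof. by rewrite mxE sumr_ge0 // => j _; rewrite mxE -expr2 sqr_ge0. Qed.

Lemma gram_row_eq0 (R : realFieldType) n (u : 'rV[R]_n) : u *m u^T = 0 -> u = 0.
Proof.
move=> h; have /eqP := congr1 (fun M : 'M_1 => M 0 0) h.
rewrite !mxE psumr_eq0 => [/allP h0|j _]; last by rewrite mxE -expr2 sqr_ge0.
apply/rowP => j; have := h0 j (mem_index_enum j).
by rewrite !mxE /= mulf_eq0 orbb => /eqP.
Qed.

Lemma gram_diag_ge0 (R : realFieldType) m n (A : 'M[R]_(m, n)) i : 0 <= (A *m A^T) i i.
Proof. by rewrite mxE sumr_ge0 // => j _; rewrite mxE -expr2 sqr_ge0. Qed.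

(** Induction on the number of rows: subtracting from the first row a its
    orthogonal projection to the span of the others does not change the Gram
    determinant, makes it a product, and does not increase the length of a.  If the
    other rows are dependent, the Gram determinant vanishes. *)
Theorem det_gram (R : realFieldType) m n (A : 'M[R]_(m, n)) :
  0 <= \det (A *m A^T) <= \prod_i (A *m A^T) i i.
Proof.
elim: m A => [|m ih]; first by move=> A; rewrite det_mx00 big_ord0 ler01 lexx.
have prod_ge0 k (B : 'M[R]_(k, n)) : 0 <= \prod_i (B *m B^T) i i.
  by apply: prodr_ge0 => i _; apply: gram_diag_ge0.
rewrite -[m.+1]/(1 + m)%N => A; rewrite -[A]vsubmxK.
move: (usubmx A) (dsubmx A) => a B {A}; set A := col_mx a B.
have eG : A *m A^T = block_mx (a *m a^T) (a *m B^T) (B *m a^T) (B *m B^T).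
  by rewrite /A tr_col_mx mul_col_row.
have /andP[D0 Dle] := ih B; set D := B *m B^T in eG D0 Dle.
have eprod : \prod_i (A *m A^T) i i = (a *m a^T) 0 0 * \prod_i D i i.
  rewrite eG big_ord_recl; congr (_ * _).
    have -> : ord0 = lshift m (0 : 'I_1) by apply: val_inj.
    by rewrite block_mxEul.
  apply: eq_bigr => i _.
  have -> : lift ord0 i = rshift 1 i by apply: val_inj.
  by rewrite block_mxEdr.
rewrite eprod; have [D00|D00] := eqVneq (\det D) 0.
  have -> : \det (A *m A^T) = 0.
    have /det0P[v v0 hv] : \det D == 0 by rewrite D00.
    have vB : v *m B = 0.
      by apply: gram_row_eq0; rewrite trmx_mul mulmxA -(mulmxA v) hv mul0mx.
    apply/eqP/det0P; exists (row_mx 0 v : 'rV_(1 + m)).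
      by apply: contra v0 => /eqP /(congr1 rsubmx); rewrite row_mxKr linear0 => ->.
    by rewrite mulmxA mul_row_col mul0mx vB addr0 mul0mx.
  by rewrite lexx mulr_ge0 ?gram_row_ge0 ?prod_ge0.
have uD : D \in unitmx by rewrite unitmxE unitfE.
pose c := a *m B^T *m invmx D; pose a' := a - c *m B.
have a'B : a' *m B^T = 0.
  by rewrite mulmxBl -mulmxA -/D /c mulmxKV // subrr.
pose P : 'M_(1 + m) := block_mx 1%:M (- c) 0 1%:M.
have PA : P *m A = col_mx a' B.
  by rewrite /A mul_block_col !mul1mx mul0mx add0r mulNmx.
have dP : \det P = 1 by rewrite det_ublock !det1 mulr1.
have eGP : P *m (A *m A^T) *m P^T = block_mx (a' *m a'^T) 0 0 D.
  have -> : P *m (A *m A^T) *m P^T = (P *m A) *m (P *m A)^T.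
    by rewrite trmx_mul !mulmxA.
  rewrite PA tr_col_mx mul_col_row a'B.
  by rewrite -[B *m a'^T]trmxK trmx_mul trmxK a'B trmx0.
have -> : \det (A *m A^T) = (a' *m a'^T) 0 0 * \det D.
  have := congr1 (@determinant _ _) eGP.
  by rewrite !det_mulmx det_tr dP mul1r mulr1 det_ublock det_mx11.
have ea : a *m a^T = a' *m a'^T + (c *m B) *m (c *m B)^T.
  have -> : a = a' + c *m B by rewrite /a' subrK.
  rewrite linearD /= mulmxDl !mulmxDr.
  have h : a' *m (c *m B)^T = 0 by rewrite trmx_mul mulmxA a'B mul0mx.
  have -> : (c *m B) *m a'^T = 0.
    by rewrite -[LHS]trmxK [X in X^T]trmx_mul trmxK h trmx0.
  by rewrite h addr0 add0r.
rewrite mulr_ge0 ?gram_row_ge0 //= ler_pM ?gram_row_ge0 //.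
have -> : (a *m a^T) 0 0 = (a' *m a'^T) 0 0 + ((c *m B) *m (c *m B)^T) 0 0.
  by rewrite ea mxE.
by rewrite lerDl gram_row_ge0.
Qed.

Definition int_mx n (X : 'M[bool]_n) : 'M[int]_n := \matrix_(i, j) (X i j : nat)%:Z.

(** The bordered matrix M has entries 1 and -1, hence rows of square length 9;
    row operations with the last row turn it into a block triangular matrix with
    blocks 2X and 1. *)
Lemma det_int_mx_bound (X : 'M[bool]_8) : (absz (\det (int_mx X)) < 79)%N.
Proof.
pose r : int -> rat := intr.
pose Y : 'M[rat]_8 := map_mx intr (int_mx X).
pose M : 'M[rat]_(8 + 1) :=
  block_mx (Y + Y - const_mx 1) (const_mx 1) (const_mx (- 1)) 1%:M.
have dM : \det M = 2 ^+ 8 * \det Y.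
  pose U : 'M[rat]_(8 + 1) := block_mx 1%:M (const_mx (-1)) 0 1%:M.
  have e : U *m M = block_mx (2 *: Y) 0 (const_mx (- 1)) 1%:M.
    rewrite mulmx_block !mul1mx !mul0mx !add0r mulmx1.
    congr block_mx; last by apply/matrixP => i j; rewrite !mxE addrN.
    apply/matrixP => i j; rewrite !mxE big_ord1 !mxE; ring.
  have := congr1 (@determinant _ _) e.
  by rewrite det_mulmx det_ublock det_lblock !det1 !mul1r mulr1 detZ.
have sq i j : M i j * M i j = 1.
  rewrite -[i]splitK -[j]splitK; case: (split i) => i'; case: (split j) => j' /=.
  - by rewrite block_mxEul !mxE; case: (X i' j').
  - by rewrite block_mxEur mxE.
  - by rewrite block_mxEdl mxE.
  - by rewrite block_mxEdr mxE !ord1.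
have diag i : (M *m M^T) i i = 9.
  rewrite mxE (eq_bigr (fun=> 1)) => [|j _]; first by rewrite sumr_const card_ord.
  by rewrite [M^T _ _]mxE sq.
have /andP[_] := det_gram M.
rewrite (eq_bigr (fun=> 9)) => [|i _]; last exact: diag.
rewrite prodr_const card_ord det_mulmx det_tr dM.
have -> : \det Y = (\det (int_mx X))%:~R by rewrite /Y det_map_mx.
set d := \det _ => h.
have ed : d%:~R ^+ 2 = ((absz d) ^ 2)%N%:R :> rat.
  by rewrite natrX -[X in _ = X ^+ 2]/((absz d)%:Z%:~R) abszE intr_norm real_normK ?num_real.
have e9 : (9 : rat) ^+ (8 + 1) = (3 ^+ 9) ^+ 2.
  by rewrite -exprM mulnC exprM; congr (_ ^+ _); rewrite expr2; ring.
(* This fact and the last one are stated for variables, so that no power is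
   expanded to unary. *)
have hb (a b : nat) (x : rat) : x ^+ 2 = (absz d ^ 2)%N%:R ->
    (a%:R * x) ^+ 2 <= b%:R ^+ 2 -> (a * absz d <= b)%N.
  move=> ex; rewrite exprMn ex -!natrX -natrM ler_nat -expnMn.
  by rewrite leq_sqr.
have {h} : (2 ^ 8 * absz d <= 3 ^ 9)%N.
  apply: (hb _ _ _ ed); rewrite !natrX -e9 expr2; exact: h.
have hc (a b m n : nat) : (b < a * n)%N -> (a * m <= b)%N -> (m < n)%N.
  by move=> h1 h2; have := leq_ltn_trans h2 h1; rewrite ltn_mul2l => /andP[].
by apply: hc; vm_cast_no_check (erefl true).
Qed.

(** * Matrices as tuples of points of the cube *)

Lemma intr79_eq0 (d : int) : (d%:~R == 0 :> F79) = (79 %| absz d)%N.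
Proof.
case: d => n; first exact: F79_natr.
by rewrite NegzE mulrNz oppr_eq0 abszN; apply: F79_natr.
Qed.

Lemma nth_lincomb d c t j : all (of_size d) t -> size c = size t ->
  nth 0 (lincomb d c t) j = \sum_(i < size t) nth 0 c i * nth 0 (nth [::] t i) j.
Proof.
have nth_vadd u v : size u = size v ->
    nth 0 (vadd u v) j = nth 0 u j + nth 0 v j.
  elim: u v j => [|a u ih] [|b v] [|k] //= [e]; rewrite ?nth_nil ?addr0 //.
  exact: ih.
elim: t c => [|v t ih] [|a c] //=.
  by rewrite big_ord0 nth_nseq if_same.
case/andP=> /eqP ev ht [ec]; rewrite big_ord_recl /= -ih // nth_vadd.
  congr (_ + _); case: (ltnP j (size v)) => hj; first by rewrite (nth_map 0).
  by rewrite !nth_default ?mulr0 // size_vscale.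
by rewrite size_vscale size_lincomb.
Qed.

Definition seq_mx d (t : seq vec) : 'M[F79]_d :=
  \matrix_(i, j) nth 0 (nth [::] t i) j.

Lemma det_seq_mx d t : size t = d -> all (of_size d) t ->
  (\det (seq_mx d t) != 0) = indep d t.
Proof.
move=> et ht; have hlc (v : 'rV[F79]_d) :
    [seq (v *m seq_mx d t) 0 j | j <- enum 'I_d] =
    lincomb d [seq v 0 i | i <- enum 'I_d] t.
  apply: (@eq_from_nth _ 0); first by rewrite size_map size_enum_ord size_lincomb.
  move=> k; rewrite size_map size_enum_ord => hk.
  rewrite (nth_map (Ordinal hk)) ?size_enum_ord // nth_lincomb //; last first.
    by rewrite size_map size_enum_ord et.
  rewrite mxE et; apply: eq_bigr => i _.
  rewrite !mxE nth_enum_ord // (nth_map i) ?size_enum_ord //.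
  by rewrite nth_ord_enum.
have row0 (v : 'rV[F79]_d) : [seq v 0 j | j <- enum 'I_d] = nseq d 0 <-> v = 0.
  split=> [h|->].
    apply/rowP => j; rewrite mxE; have := congr1 (fun s => nth 0 s j) h.
    by rewrite nth_nseq ltn_ord (nth_map j) ?size_enum_ord // nth_ord_enum.
  apply: (@eq_from_nth _ 0); rewrite size_map size_enum_ord ?size_nseq // => i hi.
  by rewrite nth_nseq hi (nth_map (Ordinal hi)) ?size_enum_ord // mxE.
rewrite -[in RHS]et; apply/idP/idP.
  move=> h; apply/(indepP ht) => c ec e; rewrite et.
  pose v : 'rV[F79]_d := \row_i nth 0 c i.
  have ev : [seq v 0 i | i <- enum 'I_d] = c.
    apply: (@eq_from_nth _ 0); rewrite size_map size_enum_ord ?ec ?et // => i hi.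
    by rewrite (nth_map (Ordinal hi)) ?size_enum_ord // mxE nth_enum_ord.
  rewrite -ev; apply/row0/eqP; apply: contraR h => v0; apply/det0P.
  by exists v => //; apply/row0; rewrite hlc ev.
move/(indepP ht) => h; apply/det0P => -[v v0 /row0].
rewrite hlc => /h; rewrite size_map size_enum_ord et => /(_ erefl) /row0 e.
by rewrite e eqxx in v0.
Qed.

Lemma mem_tuples (T : eqType) n (s : seq T) t :
  (t \in tuples n s) = (size t == n) && all (mem s) t.
Proof.
elim: n t => [|n ih] [|x t] //=; first by apply/negbTE/negP=> /allpairsP[[? ?] [_ _]].
rewrite eqSS; apply/allpairsP/idP => [[[y u]] /= [hy hu [-> ->]]|].
  by move: hu; rewrite ih => /andP[-> ->]; rewrite hy.
by case/and3P=> ht hx hs; exists (x, t); rewrite ih ht hs; split.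
Qed.

Lemma uniq_tuples (T : eqType) n (s : seq T) : uniq s -> uniq (tuples n s).
Proof.
move=> us; elim: n => //= n un; apply: allpairs_uniq => //.
by move=> [x t] [y u] _ _ /= [-> ->].
Qed.

Definition bits : seq F79 := [:: f1; f0].

Definition mx_rows n (X : 'M[bool]_n) : seq vec :=
  [seq [seq (if X i j then f1 else f0) | j <- enum 'I_n] | i <- enum 'I_n].

Lemma seq_mx_rows n (X : 'M[bool]_n) :
  seq_mx n (mx_rows X) = map_mx intr (int_mx X).
Proof.
apply/matrixP => i j; rewrite !mxE (nth_map i) ?size_enum_ord // nth_ord_enum.
by rewrite (nth_map j) ?size_enum_ord // nth_ord_enum; case: (X i j).
Qed.

Lemma size_mx_rows n (X : 'M[bool]_n) :
  size (mx_rows X) = n /\ all (of_size n) (mx_rows X).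
Proof.
rewrite /mx_rows size_map size_enum_ord; split=> //; rewrite all_map.
by apply/allP => i _; rewrite /= /of_size size_map size_enum_ord.
Qed.

Lemma unit_zero_one (X : 'M[bool]_8) :
  (zero_one_mx X \in unitmx) = indep 8 (mx_rows X).
Proof.
have [hs ha] := size_mx_rows X; rewrite -det_seq_mx // seq_mx_rows det_map_mx.
rewrite intr79_eq0 unitmxE unitfE.
have -> : zero_one_mx X = map_mx intr (int_mx X).
  by apply/matrixP => i j; rewrite !mxE; case: (X i j).
rewrite det_map_mx intr_eq0 -absz_eq0; congr (~~ _).
have [->//|h] := eqVneq (absz (\det (int_mx X))) 0%N.
by apply/esym/negbTE; rewrite gtnNdvd ?lt0n // det_int_mx_bound.
Qed.

Lemma perm_mx_rows n :
  perm_eq (map (@mx_rows n) (enum 'M[bool]_n)) (tuples n (tuples n bits)).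
Proof.
have inj : injective (@mx_rows n).
  move=> X Y e; apply/matrixP => i j.
  have nth_rows (Z : 'M[bool]_n) :
      nth 0 (nth [::] (mx_rows Z) i) j = if Z i j then f1 else f0.
    rewrite (nth_map i) ?size_enum_ord // nth_ord_enum.
    by rewrite (nth_map j) ?size_enum_ord // nth_ord_enum.
  have := nth_rows X; rewrite e nth_rows.
  by case: (X i j) (Y i j) => [] [].
apply: uniq_perm; first by rewrite map_inj_uniq ?enum_uniq.
  by rewrite !uniq_tuples.
move=> t; apply/mapP/idP => [[X _ ->]|].
  have [/eqP hs _] := size_mx_rows X; rewrite mem_tuples hs /= all_map.
  apply/allP => i _ /=; rewrite mem_tuples size_map size_enum_ord eqxx all_map.
  by apply/allP => j _ /=; case: (X i j).
rewrite mem_tuples => /andP[/eqP et /allP ht].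
exists (\matrix_(i, j) (nth 0 (nth [::] t i) j == 1)); first by rewrite mem_enum.
apply/esym; apply: (@eq_from_nth _ [::]);
  rewrite size_map size_enum_ord ?et // => i hi.
rewrite (nth_map (Ordinal hi)) ?size_enum_ord //.
have : nth [::] t i \in t by rewrite mem_nth ?et.
move/ht; rewrite inE mem_tuples => /andP[/eqP er /allP hr].
apply: (@eq_from_nth _ 0); rewrite size_map size_enum_ord ?er // => j hj.
rewrite (nth_map (Ordinal hj)) ?size_enum_ord // mxE !nth_enum_ord //.
have : nth 0 (nth [::] t i) j \in nth [::] t i by rewrite mem_nth ?er.
by move/hr; rewrite !inE => /orP[] /eqP ->.
Qed.

Lemma card_nonsingular :
  #|nonsingular_zero_one 8| = count_indep 8 (tuples 8 bits).
Proof.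
rewrite count_indepE -(permP (perm_mx_rows 8)) count_map enumT.
rewrite cardE /enum_mem size_filter; apply: eq_count => X.
by rewrite -[LHS]/(X \in nonsingular_zero_one 8) inE unit_zero_one.
Qed.

(** * Evaluation *)

Definition unit_vec (i : nat) : vec :=
  map (fun j => if eqn i j then f1 else f0) (iota 0 8).

Definition config8 : config := rcons (map unit_vec (iota 0 8)) (nseq 8 f1).

(** Levels are stored in evaluated form, so that each step can be checked
    separately.  The checks compare with a boolean test: its value is a constructor,
    whose computation is carried out once, with sharing. *)

Definition level8 : level := [:: (config8, 1%num)].
Definition level7 : level := Eval vm_compute in absorb [::] level8.
Definition level6 : level := Eval vm_compute in absorb [::] level7.
Definition level5 : level := Eval vm_compute in absorb [::] level6.
Definition level4 : level := Eval vm_compute in absorb [::] level5.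
Definition level4a : level := Eval vm_compute in take 60 level4.
Definition level4b : level := Eval vm_compute in take 60 (drop 60 level4).
Definition level4c : level := Eval vm_compute in take 60 (drop 120 level4).
Definition level4d : level := Eval vm_compute in drop 180 level4.
Definition level3a : level := Eval vm_compute in absorb [::] level4a.
Definition level3b : level := Eval vm_compute in absorb level3a level4b.
Definition level3c : level := Eval vm_compute in absorb level3b level4c.
Definition level3 : level := Eval vm_compute in absorb level3c level4d.

Lemma level7_check : eq_level (absorb [::] level8) level7.
Proof. vm_cast_no_check (erefl true). Qed.

Lemma level6_check : eq_level (absorb [::] level7) level6.
Proof. vm_cast_no_check (erefl true). Qed.

Lemma level5_check : eq_level (absorb [::] level6) level5.
Proof. vm_cast_no_check (erefl true). Qed.

Lemma level4_check : eq_level (absorb [::] level5) level4.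
Proof. vm_cast_no_check (erefl true). Qed.

Lemma level3a_check : eq_level (absorb [::] level4a) level3a.
Proof. vm_cast_no_check (erefl true). Qed.

Lemma level3b_check : eq_level (absorb level3a level4b) level3b.
Proof. vm_cast_no_check (erefl true). Qed.

Lemma level3c_check : eq_level (absorb level3b level4c) level3c.
Proof. vm_cast_no_check (erefl true). Qed.

Lemma level3_check : eq_level (absorb level3c level4d) level3.
Proof. vm_cast_no_check (erefl true). Qed.

Lemma count3_check : N.eqb (3 * count3 level3) 10160459763342013440.
Proof. vm_cast_no_check (erefl true). Qed.

Lemma level4_split :
  eq_level (level4a ++ level4b ++ level4c ++ level4d) level4.
Proof. vm_cast_no_check (erefl true). Qed.

(** * The number of nonsingular matrices *)

Lemma level_count_cat d l m :
  level_count d (l ++ m) = (level_count d l + level_count d m)%N.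
Proof. exact: big_cat. Qed.

Lemma level_count_nil d : level_count d [::] = 0%N.
Proof. exact: big_nil. Qed.

Definition proper_level (d : nat) (l : level) : bool :=
  all (fun Kw => proper_config d Kw.1) l.

Lemma level_count_step d acc l m :
  proper_level d.+1 l -> eq_level (absorb acc l) m ->
  (2 * level_count d m = 2 * level_count d acc + level_count d.+1 l)%N.
Proof. by move=> hl /eq_levelP <-; apply: level_count_absorb. Qed.

Lemma level_count_start d l m :
  proper_level d.+1 l -> eq_level (absorb [::] l) m ->
  (2 * level_count d m = level_count d.+1 l)%N.
Proof. by move=> hl /(level_count_step hl) ->; rewrite level_count_nil muln0. Qed.

Lemma levels_proper :
  [&& proper_level 8 level8, proper_level 7 level7, proper_level 6 level6,
      proper_level 5 level5, proper_level 4 level4a, proper_level 4 level4b,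
      proper_level 4 level4c, proper_level 4 level4d & proper_level 3 level3].
Proof. vm_cast_no_check (erefl true). Qed.

(** With a positive sign of (1, ..., 1), each coordinate is 1 + 1 or 1 - 1; the
    two lists even agree in their order. *)
Lemma half_sums8 : half_sums config8 = map (vscale f2) (tuples 8 bits).
Proof. vm_cast_no_check (erefl (half_sums config8)). Qed.

Lemma level_count8 :
  level_count 8 level8 = (256 * #|nonsingular_zero_one 8|)%N.
Proof.
have hbits : all (of_size 8) (tuples 8 bits).
  by apply/allP => t; rewrite mem_tuples => /andP[].
rewrite /level_count /weighted_sum big_seq1 mul1n card_nonsingular.
have h8 : all (of_size 8) config8 by [].
rewrite (count_indep_perm _ (full_sums_half h8 _)) // half_sums8.
have hf : injective_linear 8 (vscale f2).
  split=> [v ev|u v _ _|c v _|v _].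
  - by rewrite size_vscale.
  - exact: vscaleDr.
  - by rewrite !vscaleA mulrC.
  - by rewrite nonzero_scale.
rewrite (@count_indep_sym 8); [|exact: all_size_map hf hbits|by []].
by rewrite (count_indep_map _ hf hbits).
Qed.

(* The value is a binary numeral sent to nat by ssrnat's nat_of_bin, since a
   unary numeral of this size cannot be handled. *)
Theorem mainTheorem1 :
  #|nonsingular_zero_one 8| = nat_of_bin 10160459763342013440%num.
Proof.
have /and5P[p8 p7 p6 p5 /and5P[p4a p4b p4c p4d p3]] := levels_proper.
have e7 := level_count_start p8 level7_check.
have e6 := level_count_start p7 level6_check.
have e5 := level_count_start p6 level5_check.
have e4 := level_count_start p5 level4_check.
have e3a := level_count_start p4a level3a_check.
have e3b := level_count_step p4b level3b_check.
have e3c := level_count_step p4c level3c_check.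
have e3 := level_count_step p4d level3_check.
have s4 : level_count 4 level4 =
    (level_count 4 level4a + (level_count 4 level4b +
      (level_count 4 level4c + level_count 4 level4d)))%N.
  by rewrite -(eq_levelP level4_split) !level_count_cat.
rewrite (nat_of_bin_triple count3_check).
(* Five steps with a factor 2 each, and 2^5 * 24 = 2^8 * 3. *)
have := level_count3 p3; have := level_count8.
move: e7 e6 e5 e4 e3a e3b e3c e3 s4.
(* As variables, the counts cannot be evaluated by the tactics. *)
generalize #|nonsingular_zero_one 8| (nat_of_bin (count3 level3)).
generalize (level_count 8 level8) (level_count 7 level7) (level_count 6 level6).
generalize (level_count 5 level5) (level_count 4 level4) (level_count 4 level4a).
generalize (level_count 4 level4b) (level_count 4 level4c).
generalize (level_count 4 level4d) (level_count 3 level3a).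
generalize (level_count 3 level3b) (level_count 3 level3c) (level_count 3 level3).
lia.
Qed.
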